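(* The universal covering $\widetilde F_2(L_{7,1})$ of the configuration space $F_2(L_{7,1})$ is homotopy equivalent to $\left(\bigvee_6 S^2\right)\times S^3$, the product of a wedge of six $2$-spheres with $S^3$.
   Context: Let $S^3=\{(x_1,x_2)\in\mathbb{C}\times\mathbb{C}:|x_1|^2+|x_2|^2=1\}$. The lens space $L_{7,1}$ is $S^3/\mathbb{Z}_7$, where the generator of $\mathbb{Z}_7$ acts by $(x_1,x_2)\mapsto(e^{2\pi i/7}x_1,e^{2\pi i/7}x_2)$. $F_2(M)$ denotes the space of ordered pairs of distinct points of $M$. The universal covering $\widetilde F_2(L_{7,1})$ is the orbit configuration space $\{(x,y)\in S^3\times S^3 : x\neq g(y)\text{ for all }g\in\mathbb{Z}_7\}$. *)

(* Defs.v *)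
From HB Require Import structures.
From mathcomp Require Import all_boot all_order all_algebra generic_quotient.
From mathcomp Require Import complex.
From mathcomp Require Import all_classical all_reals topology normedtype trigo.
From mathcomp Require Import homotopy.

Set Implicit Arguments.
Unset Strict Implicit.
Unset Printing Implicit Defensive.

Import Order.TTheory GRing.Theory Num.Theory.
Import numFieldNormedType.Exports.

Local Open Scope classical_set_scope.
Local Open Scope complex_scope.
Local Open Scope ring_scope.
Local Open Scope quotient_scope.

(* The parameter of a homotopy ranges over the closed unit interval of the
   realType [R]; functions on it are functions on [R] that are continuous on
   the interval for the subspace topology. *)
Section Homotopy.
Variable R : realType.

Definition homotopic (X Y : topologicalType) (f g : X -> Y) : Prop :=
  exists H : R * X -> Y,
    [/\ {within `[0, 1]%classic `*` [set: X], continuous H},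
        forall x, H (0, x) = f x & forall x, H (1, x) = g x].

Definition homotopy_equivalent (X Y : topologicalType) : Prop :=
  exists (f : X -> Y) (g : Y -> X),
    [/\ continuous f, continuous g, homotopic (g \o f) id &
        homotopic (f \o g) id].

Definition path_from_to (X : topologicalType) (x y : X) (c : R -> X) : Prop :=
  [/\ {within `[0, 1]%classic, continuous c}, c 0 = x & c 1 = y].

Definition path_connected (X : topologicalType) : Prop :=
  [set: X] !=set0 /\ forall x y : X, exists c, path_from_to x y c.

Definition path_homotopic (X : topologicalType) (x y : X) (c d : R -> X) :
    Prop :=
  exists H : R * R -> X,
    [/\ {within `[0, 1]%classic `*` `[0, 1]%classic, continuous H},
        {in `[0, 1], forall t, H (0, t) = c t},
        {in `[0, 1], forall t, H (1, t) = d t},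
        {in `[0, 1], forall s, H (s, 0) = x} &
        {in `[0, 1], forall s, H (s, 1) = y}].

Definition simply_connected (X : topologicalType) : Prop :=
  path_connected X /\
  forall (x : X) (c : R -> X), path_from_to x x c ->
    path_homotopic x x c (cst x).

(* The inverse homeomorphism [U -> V i] is given by a function [s] on [B], of
   which only the restriction to [U] matters. *)
Definition evenly_covered (E B : topologicalType) (p : E -> B) (U : set B) :
    Prop :=
  exists (I : Type) (V : I -> set E),
    [/\ forall i, open (V i),
        trivIset [set: I] V,
        p @^-1` U = \bigcup_i V i &
        forall i, exists s : B -> E,
          [/\ {within U, continuous s},
              forall b, U b -> V i (s b) /\ p (s b) = b &
              forall e, V i e -> s (p e) = e]].

Definition covering_map (E B : topologicalType) (p : E -> B) : Prop :=
  [/\ continuous p, range p = [set: B] &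
      forall b, exists U, [/\ open U, U b & evenly_covered p U]].

Definition universal_covering (E B : topologicalType) (p : E -> B) : Prop :=
  covering_map p /\ simply_connected E.

End Homotopy.

Definition F2 (M : topologicalType) : topologicalType :=
  set_type [set p : M * M | p.1 <> p.2].

Section Lens.
Variable R : realType.

(* [R[i]^o] is [R[i]] with the topology of the norm. *)
Local Notation C := (R[i]^o).

Definition S3_set : set (C * C) :=
  [set x | `|x.1| ^+ 2 + `|x.2| ^+ 2 = 1].

Definition S3 : topologicalType := set_type S3_set.

Definition zeta7 : R[i] := cos (2 * pi / 7) +i* sin (2 * pi / 7).

Definition rot7 (k : nat) (x : C * C) : C * C :=
  (zeta7 ^+ k * x.1, zeta7 ^+ k * x.2).

Definition lens_rel (x y : S3) : bool :=
  [exists k : 'I_7, \val x == rot7 k (\val y)].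

Lemma cos_sin_natmul (a : R) n :
  (cos a +i* sin a) ^+ n = cos (a *+ n) +i* sin (a *+ n).
Proof.
elim: n => [|n IH]; first by rewrite expr0 !mulr0n cos0 sin0.
rewrite exprS IH !mulrS cosD sinD; apply/eqP; rewrite eq_complex /=.
by rewrite [X in _ && (X == _)]addrC !eqxx.
Qed.

Lemma zeta7_expr7 : zeta7 ^+ 7 = 1.
Proof.
rewrite /zeta7 cos_sin_natmul -[_ *+ 7]mulr_natr divfK ?pnatr_eq0//.
by rewrite mulrC mulr_natr cos2pi sin2pi.
Qed.

Lemma rot7D m n x : rot7 m (rot7 n x) = rot7 (m + n) x.
Proof. by rewrite /rot7 /= !mulrA exprD. Qed.

Lemma rot7_mod n x : rot7 (n %% 7) x = rot7 n x.
Proof. by rewrite /rot7 (expr_mod n zeta7_expr7). Qed.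

Lemma rot70 x : rot7 0 x = x.
Proof. by case: x => a b; rewrite /rot7 expr0 !mul1r. Qed.

Lemma lens_relP (x y : S3) :
  reflect (exists n, \val x = rot7 n (\val y)) (lens_rel x y).
Proof.
apply: (iffP existsP) => [[k /eqP ->]|[n E]]; first by exists k.
exists (Ordinal (ltn_pmod n (isT : 0 < 7)%N)); apply/eqP.
by rewrite E -rot7_mod.
Qed.

Lemma lens_rel_equiv : equiv_class_of lens_rel.
Proof.
have sym x y : lens_rel x y -> lens_rel y x.
  move=> /existsP[k /eqP E]; apply/lens_relP; exists (7 - k)%N.
  by rewrite E rot7D subnK ?(ltnW (ltn_ord k))// -rot7_mod modnn rot70.
split=> [x|x y|y x z].
- by apply/lens_relP; exists 0%N; rewrite rot70.
- by apply/idP/idP; exact: sym.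
- move=> /lens_relP[m E] /lens_relP[n F]; apply/lens_relP; exists (m + n)%N.
  by rewrite E F rot7D.
Qed.

Canonical lens_equiv := EquivRelPack lens_rel_equiv.

Definition L71 : topologicalType := quotient_topology {eq_quot lens_equiv}.

Definition lens_proj (x : S3) : L71 := \pi_({eq_quot lens_equiv}) x.

Lemma lens_projP (x y : S3) :
  lens_proj x = lens_proj y <-> exists k : 'I_7, \val x = rot7 k (\val y).
Proof.
split=> [/eqmodP/existsP[k /eqP]|[k E]]; first by exists k.
by apply/eqmodP/existsP; exists k; apply/eqP.
Qed.

Definition orbit_F2_set : set (S3 * S3) :=
  [set p | forall k : 'I_7, \val p.1 <> rot7 k (\val p.2)].

Definition orbit_F2 : topologicalType := set_type orbit_F2_set.

Lemma orbit_F2_proj_subproof (p : orbit_F2) :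
  (lens_proj (\val p).1, lens_proj (\val p).2)
    \in [set q : L71 * L71 | q.1 <> q.2].
Proof.
by apply/mem_set => /= /lens_projP[k E]; exact: (set_mem (valP p)) k E.
Qed.

Definition orbit_F2_proj (p : orbit_F2) : F2 L71 :=
  exist _ (lens_proj (\val p).1, lens_proj (\val p).2)
    (orbit_F2_proj_subproof p).

Definition S2_set : set 'rV[R]_3 := [set v | \sum_(i < 3) v 0 i ^+ 2 = 1].

Definition S2 : topologicalType := set_type S2_set.

Lemma S2_base_subproof : (delta_mx 0 0 : 'rV[R]_3) \in S2_set.
Proof.
apply/mem_set; rewrite /S2_set /= (bigD1 0)//= big1 => [|i i0].
  by rewrite mxE !eqxx expr1n addr0.
by rewrite mxE (negbTE i0) andbF expr0n.
Qed.

Definition S2_base : S2 := exist _ (delta_mx 0 0) S2_base_subproof.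

Definition wedge_S2 (n : nat) : topologicalType :=
  wedge (fun _ : 'I_n => S2_base).

End Lens.

(* Main.v *)
(* Quaternion division [(x, y) |-> (x y^-1, y)] identifies the orbit configuration
   space with X x S^3, where X is S^3 minus the seven points (zeta^k, 0), which lie
   on one great circle.

   X is equivalent to a wedge of six spheres: the midpoints m_0, ..., m_6 of the
   seven arcs of the circle carry pairwise disjoint open caps, each bounded by a
   hyperplane through two adjacent punctures.  Collapsing the complement of the caps
   of m_0, ..., m_5 maps X to the wedge; conversely the i-th sphere is the round
   2-sphere in S^3 having m_6 and m_i as antipodal points.  Both composites are
   homotopic to the identity by normalized straight-line homotopies: these keep the
   argument of the second complex coordinate, so they could only meet a puncture on
   the circle, where they stay inside one arc.

   S^3 and X are retracts of R^4 minus closed subsets of finitely many lines.  In such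
   a complement a loop is homotopic to a polygon with generic vertices, and the cone
   over it from its base point misses the lines, as 2 + 1 < 4.

   The projection is a covering because it is the quotient map of the free action of
   Z_7 x Z_7. *)
Require Import Defs.
From mathcomp Require Import all_boot all_order all_algebra.
From mathcomp Require Import complex zify ring lra.
From mathcomp Require Import all_classical all_reals topology normedtype trigo.
From mathcomp Require Import homotopy realfun.

Set Implicit Arguments.
Unset Strict Implicit.
Unset Printing Implicit Defensive.

Import Order.TTheory GRing.Theory Num.Theory.
Import numFieldNormedType.Exports.

Local Open Scope classical_set_scope.
Local Open Scope complex_scope.
Local Open Scope ring_scope.
Local Open Scope quotient_scope.

Local Notation Re := (@complex.Re _).
Local Notation Im := (@complex.Im _).

(** * Homotopy equivalences and simple connectivity *)

Section Subspaces.

(** The division is by [y] on the right because the generator of Z_7 acts as left multiplication by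
    (zeta, 0): then x = zeta^k y amounts to x y^-1 = (zeta^k, 0), and the punctures no longer depend
    on y. Seven caps give only six spheres because m_6 is the common base point, so its cap is
    collapsed with the rest. A point of the seventh arc is still sent into its own arc, which keeps
    the homotopy off the punctures there too. Maps into the spheres are normalizations of explicit
    vectors. Their continuity amounts to these vectors not vanishing, and a homotopy in X amounts to
    segments that avoid the seven closed rays through the punctures. What has to be known is the
    sign of the functions [cap] at midpoints and punctures; as these functions are affine, signs
    propagate along segments. *)

Lemma set_val_continuous (T : topologicalType) (A : set T) :
  continuous (\val : set_type A -> T).
Proof. exact: initial_continuous. Qed.

Lemma continuous_at_set_type (T U : topologicalType) (A : set U) (f : T -> set_type A)
    (x : T) :
  continuous_at x (fun t => \val (f t)) -> continuous_at x f.
Proof.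
move=> cf V [/= _ [[W oW <-] Wfx WV]].
by apply: filterS WV _; apply: cf; exact: open_nbhs_nbhs.
Qed.

Lemma within_continuousT (T U : topologicalType) (A : set T) (f : T -> U) :
  {within A, continuous f} <->
  forall x, A x -> forall V, nbhs (f x) V ->
    \forall y \near x, A y -> V (f y).
Proof.
split=> [/subspace_continuousP cf x Ax V /(cf x Ax)//|cf].
by apply/subspace_continuousP => x Ax V /(cf x Ax).
Qed.

Lemma within_continuous_precomp (T U W : topologicalType) (A : set T)
    (B : set U) (phi : U -> T) (h : T -> W) :
  (forall u, B u -> A (phi u)) -> {within B, continuous phi} ->
  {within A, continuous h} -> {within B, continuous (h \o phi)}.
Proof.
move=> BA /within_continuousT cphi /within_continuousT ch.
apply/within_continuousT => u Bu V /(ch _ (BA _ Bu)) /(cphi _ Bu).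
by apply: filterS => y Vy By; apply: Vy => //; exact: BA.
Qed.

Lemma within_continuous_postcomp (T U W : topologicalType) (A : set T)
    (h : T -> U) (g : U -> W) :
  {within A, continuous h} -> (forall x, A x -> {for h x, continuous g}) ->
  {within A, continuous (g \o h)}.
Proof.
move=> /within_continuousT ch cg; apply/within_continuousT => x Ax V Vx.
by apply: (ch _ Ax (g @^-1` V)); exact: cg.
Qed.

Lemma within_continuous_pair (T U W : topologicalType) (A : set T)
    (f : T -> U) (g : T -> W) :
  {within A, continuous f} -> {within A, continuous g} ->
  {within A, continuous (fun x => (f x, g x))}.
Proof.
move=> /within_continuousT cf /within_continuousT cg.
apply/within_continuousT => x Ax V [[/= V1 V2] [/= n1 n2] V12].
by apply: filterS2 (cf x Ax _ n1) (cg x Ax _ n2) => y V1y V2y Ay; apply: V12;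
  split; [exact: V1y|exact: V2y].
Qed.

Lemma continuous_at_pair (T U W : topologicalType) (f : T -> U) (g : T -> W)
    (x : T) :
  continuous_at x f -> continuous_at x g ->
  continuous_at x (fun t => (f t, g t)).
Proof. by move=> cf cg; exact: cvg_pair. Qed.

End Subspaces.

Section HomotopyEquivalence.
Variable R : realType.
Implicit Types X Y Z : topologicalType.

Lemma homotopic_continuous X Y (f g : X -> Y) (H : R * X -> Y) :
  continuous H -> (forall x, H (0, x) = f x) -> (forall x, H (1, x) = g x) ->
  homotopic R f g.
Proof. by move=> cH H0 H1; exists H; split => //; exact: continuous_subspaceT. Qed.

Lemma homotopic_postcomp X Y Z (f g : X -> Y) (h : Y -> Z) :
  continuous h -> homotopic R f g -> homotopic R (h \o f) (h \o g).
Proof.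
move=> ch [H [cH H0 H1]]; exists (h \o H); split.
- by apply: within_continuous_postcomp => // x _; exact: ch.
- by move=> x /=; rewrite H0.
- by move=> x /=; rewrite H1.
Qed.

Lemma homotopic_precomp X Y Z (f g : Y -> Z) (h : X -> Y) :
  continuous h -> homotopic R f g -> homotopic R (f \o h) (g \o h).
Proof.
move=> ch [H [cH H0 H1]]; exists (H \o (fun p => (p.1, h p.2))); split.
- apply: within_continuous_precomp cH; first by move=> [s x] [].
  apply: continuous_subspaceT => p; apply: continuous_at_pair.
    exact: cvg_fst.
  by apply: continuous_comp; [exact: cvg_snd|exact: ch].
- by move=> x /=; rewrite H0.
- by move=> x /=; rewrite H1.
Qed.

Lemma homotopy_equivalent_homeo X Y Z (f : X -> Y) (g : Y -> X) :
  continuous f -> continuous g -> cancel f g -> cancel g f ->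
  homotopy_equivalent R Y Z -> homotopy_equivalent R X Z.
Proof.
move=> cf cg fK gK [h [k [ch ck hk kh]]]; exists (h \o f), (g \o k); split.
- by move=> x; apply: continuous_comp; [exact: cf|exact: ch].
- by move=> x; apply: continuous_comp; [exact: ck|exact: cg].
- have := homotopic_precomp cf (homotopic_postcomp cg hk).
  by congr homotopic; apply/funext => x /=; rewrite fK.
- have -> : (h \o f) \o (g \o k) = h \o k by apply/funext => x /=; rewrite gK.
  exact: kh.
Qed.

Lemma homotopic_prod_id X Y Z (f g : X -> Y) :
  homotopic R f g ->
  homotopic R (fun p : X * Z => (f p.1, p.2)) (fun p : X * Z => (g p.1, p.2)).
Proof.
move=> [H [cH H0 H1]].
exists (fun p => (H (p.1, p.2.1), p.2.2)); split.
- apply: within_continuous_pair; last first.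
    apply: continuous_subspaceT => p.
    by apply: (@continuous_comp _ _ _ snd snd); exact: cvg_snd.
  apply: (@within_continuous_precomp _ _ _ _ _ (fun p => (p.1, p.2.1)) H _ _ cH).
    by move=> [s x] [].
  apply: continuous_subspaceT => p; apply: continuous_at_pair.
    exact: cvg_fst.
  by apply: (@continuous_comp _ _ _ snd fst); [exact: cvg_snd|exact: cvg_fst].
- by move=> [x z] /=; rewrite H0.
- by move=> [x z] /=; rewrite H1.
Qed.

Lemma homotopy_equivalent_prod X Y Z :
  homotopy_equivalent R X Y -> homotopy_equivalent R (X * Z)%type (Y * Z)%type.
Proof.
move=> [f [g [cf cg gf fg]]].
exists (fun p => (f p.1, p.2)), (fun p => (g p.1, p.2)); split.
- move=> p; apply: continuous_at_pair; last exact: cvg_snd.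
  by apply: continuous_comp; [exact: cvg_fst|exact: cf].
- move=> p; apply: continuous_at_pair; last exact: cvg_snd.
  by apply: continuous_comp; [exact: cvg_fst|exact: cg].
- have := homotopic_prod_id Z gf.
  by congr homotopic; apply/funext => -[].
- have := homotopic_prod_id Z fg.
  by congr homotopic; apply/funext => -[].
Qed.

(** A loop in [X] is contracted in [Y], and [r] carries the contraction back because it undoes [i]
    on the boundary values. *)
Lemma simply_connected_retract X Y (i : X -> Y) (r : Y -> X) :
  continuous i -> continuous r -> cancel i r ->
  simply_connected R Y -> simply_connected R X.
Proof.
move=> ci cr iK [[[y0 _] Ypc] Ysc]; split.
  split; first by exists (r y0).
  move=> x y; have [c [cc c0 c1]] := Ypc (i x) (i y).
  exists (r \o c); split; rewrite /= ?c0 ?c1 ?iK//.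
  by apply: within_continuous_postcomp => // t _; exact: cr.
move=> x c [cc c0 c1].
have [|H [cH H0 H1 Hl Hr]] := Ysc (i x) (i \o c).
  split; rewrite /= ?c0 ?c1//.
  by apply: within_continuous_postcomp => // t _; exact: ci.
exists (r \o H); split.
- by apply: within_continuous_postcomp => // t _; exact: cr.
- by move=> t t01 /=; rewrite H0//= iK.
- by move=> t t01 /=; rewrite H1//= iK.
- by move=> t t01 /=; rewrite Hl//= iK.
- by move=> t t01 /=; rewrite Hr//= iK.
Qed.

Lemma simply_connected_prod X Y :
  simply_connected R X -> simply_connected R Y ->
  simply_connected R (X * Y)%type.
Proof.
move=> [[[x0 _] Xpc] Xsc] [[[y0 _] Ypc] Ysc]; split.
  split; first by exists (x0, y0).
  move=> [x y] [x' y'].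
  have [c [cc c0 c1]] := Xpc x x'; have [d [cd d0 d1]] := Ypc y y'.
  exists (fun t => (c t, d t)); split; rewrite ?c0 ?c1 ?d0 ?d1//.
  exact: within_continuous_pair.
move=> [x y] c [cc c0 c1].
have [|H [cH H0 H1 Hl Hr]] := Xsc x (fst \o c).
  split; rewrite /= ?c0 ?c1//.
  by apply: within_continuous_postcomp => // t _; exact: cvg_fst.
have [|K [cK K0 K1 Kl Kr]] := Ysc y (snd \o c).
  split; rewrite /= ?c0 ?c1//.
  by apply: within_continuous_postcomp => // t _; exact: cvg_snd.
exists (fun p => (H p, K p)); split.
- exact: within_continuous_pair.
- by move=> t t01 /=; rewrite H0// K0//=; case: (c t).
- by move=> t t01 /=; rewrite H1// K1.
- by move=> t t01 /=; rewrite Hl// Kl.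
- by move=> t t01 /=; rewrite Hr// Kr.
Qed.

End HomotopyEquivalence.

(** * Continuity at a point of the algebraic operations *)

Section PointwiseContinuity.
Variables (R : realType) (T : topologicalType) (x : T).

Lemma continuous_at_cst (U : topologicalType) (c : U) :
  continuous_at x (fun=> c).
Proof. exact: cvg_cst. Qed.

Lemma continuous_at_comp (U W : topologicalType) (g : U -> W) (f : T -> U) :
  continuous_at x f -> continuous_at (f x) g ->
  continuous_at x (fun t => g (f t)).
Proof. exact: continuous_comp. Qed.

Lemma continuous_atD (W : normedModType R) (f g : T -> W) :
  continuous_at x f -> continuous_at x g ->
  continuous_at x (fun t => f t + g t).
Proof. by move=> cf cg; exact: cvgD. Qed.

Lemma continuous_atN (W : normedModType R) (f : T -> W) :
  continuous_at x f -> continuous_at x (fun t => - f t).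
Proof. by move=> cf; exact: cvgN. Qed.

Lemma continuous_atZ (W : normedModType R) (s : T -> R) (f : T -> W) :
  continuous_at x s -> continuous_at x f ->
  continuous_at x (fun t => s t *: f t).
Proof. by move=> cs cf; exact: cvgZ. Qed.

Lemma continuous_atM (f g : T -> R) :
  continuous_at x f -> continuous_at x g ->
  continuous_at x (fun t => f t * g t).
Proof. by move=> cf cg; exact: cvgM. Qed.

Lemma continuous_atX (n : nat) (f : T -> R) :
  continuous_at x f -> continuous_at x (fun t => f t ^+ n).
Proof.
move=> cf; elim: n => [|n IH]; first exact: cvg_cst.
by under [fun t => _]eq_fun do rewrite exprS; exact: continuous_atM.
Qed.

Lemma continuous_atV (f : T -> R) :
  f x != 0 -> continuous_at x f -> continuous_at x (fun t => (f t)^-1).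
Proof. by move=> fx0 cf; exact: cvgV. Qed.

Lemma continuous_at_sqrt (f : T -> R) :
  continuous_at x f -> continuous_at x (fun t => Num.sqrt (f t)).
Proof. by move=> cf; apply: continuous_comp => //; exact: (@sqrt_continuous R). Qed.

Lemma continuous_at_max (f g : T -> R) :
  continuous_at x f -> continuous_at x g ->
  continuous_at x (fun t => Num.max (f t) (g t)).
Proof. exact: continuous_max. Qed.

Lemma continuous_at_min (f g : T -> R) :
  continuous_at x f -> continuous_at x g ->
  continuous_at x (fun t => Num.min (f t) (g t)).
Proof. exact: continuous_min. Qed.

Lemma continuous_at_sum (W : normedModType R) (I : Type) (s : seq I)
    (P : pred I) (f : I -> T -> W) :
  (forall i, continuous_at x (f i)) ->
  continuous_at x (fun t => \sum_(i <- s | P i) f i t).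
Proof.
move=> cf; elim: s => [|i s IH].
  by under [fun t => _]eq_fun do rewrite big_nil; exact: cvg_cst.
under [fun t => _]eq_fun do rewrite big_cons.
by case: (P i) => //; apply: continuous_atD.
Qed.

Lemma continuous_at_row (n : nat) (f : T -> 'rV[R]_n.+1) :
  (forall i, continuous_at x (fun t => f t 0 i)) -> continuous_at x f.
Proof.
move=> cf; apply/cvgrPdist_lt => e e0.
have : \forall t \near x, forall i : 'I_n.+1, `|f x 0 i - f t 0 i| < e.
  by apply: filter_forall => i; move/cvgrPdist_lt : (cf i); exact.
apply: filterS => t ft; rewrite [ltLHS]mx_normrE.
by apply/bigmax_ltP; split => // -[i j] _ /=; rewrite !mxE (ord1 i).
Qed.

Lemma continuous_at_coord (m n : nat) (f : T -> 'M[R]_(m.+1, n.+1)) i j :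
  continuous_at x f -> continuous_at x (fun t => f t i j).
Proof.
by move=> cf; exact: (continuous_at_comp cf (@coord_continuous _ _ _ i j (f x))).
Qed.

Lemma continuous_at_val (U : topologicalType) (A : set U)
    (f : T -> set_type A) :
  continuous_at x f -> continuous_at x (fun t => \val (f t)).
Proof. by move=> cf; apply: continuous_comp => //; exact: set_val_continuous. Qed.

End PointwiseContinuity.

(* Partial applications such as [GRing.mul a] arise from the eta-reduction that
   unification performs on [fun t => a * t]. *)
Ltac continuity :=
  repeat match goal with
  | |- continuous_at _ (fun=> ?c) => exact: continuous_at_cst
  | |- continuous_at _ (cst _) => exact: continuous_at_cst
  | |- continuous_at _ (fun t => t) => exact: cvg_id
  | |- continuous_at _ id => exact: cvg_id
  | |- continuous_at _ fst => exact: cvg_fst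
  | |- continuous_at _ snd => exact: cvg_snd
  | |- continuous_at _ (fun t => _ + _) => apply: continuous_atD
  | |- continuous_at _ (+%R ?a) =>
      apply: (continuous_atD (f := fun=> a) (g := fun t => t))
  | |- continuous_at _ (fun t => - _) => apply: continuous_atN
  | |- continuous_at _ -%R => apply: (continuous_atN (f := fun t => t))
  | |- continuous_at _ (fun t => _ *: _) => apply: continuous_atZ
  | |- continuous_at _ ( *:%R ?a) =>
      apply: (continuous_atZ (s := fun=> a) (f := fun t => t))
  | |- continuous_at _ (fun t => _ * _) => apply: continuous_atM
  | |- continuous_at _ ( *%R ?a) =>
      apply: (continuous_atM (f := fun=> a) (g := fun t => t))
  | |- continuous_at _ (fun t => _ ^+ _) => apply: continuous_atX
  | |- continuous_at _ (fun t => _^-1) => apply: continuous_atV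
  | |- continuous_at _ (fun t => Num.sqrt _) => apply: continuous_at_sqrt
  | |- continuous_at _ (fun t => Num.max _ _) => apply: continuous_at_max
  | |- continuous_at _ (fun t => Num.min _ _) => apply: continuous_at_min
  | |- continuous_at _ (Num.max ?a) =>
      apply: (continuous_at_max (f := fun=> a) (g := fun t => t))
  | |- continuous_at _ (Num.min ?a) =>
      apply: (continuous_at_min (f := fun=> a) (g := fun t => t))
  | |- continuous_at _ (fun t => \sum_(_ <- _ | _) _) =>
      apply: continuous_at_sum => ?
  end.

(** * Simple connectivity of complements of lines *)

Section GeneralPosition.
Variables (R : realType) (n : nat).
Local Notation V := 'rV[R]_n.+4.

Lemma mulmx_row_continuous (u : 'cV[R]_n.+4) :
  continuous (fun v : V => (v *m u) 0 0).
Proof.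
have -> : (fun v : V => (v *m u) 0 0) = fun v => \sum_j v 0 j * u j 0.
  by apply/funext => v; rewrite mxE.
by move=> v; continuity; apply: continuous_at_coord; exact: cvg_id.
Qed.

(** A point [v] on the hyperplane of [u] leaves it when moved along [u^T], since [u] pairs with its
    transpose to a nonzero sum of squares. Removing one hyperplane leaves a nonempty open set, to
    which induction applies. *)
Lemma open_avoid_hyperplanes (s : seq 'cV[R]_n.+4) (O : set V) :
  {in s, forall u, u != 0} -> open O -> O !=set0 ->
  exists2 v, O v & {in s, forall u, (v *m u) 0 0 != 0}.
Proof.
elim: s O => [|u s IH] O s0 oO [v Ov]; first by exists v.
have u0 : u != 0 by apply: s0; rewrite mem_head.
pose O' := O `&` [set w | (w *m u) 0 0 != 0].
have oO' : open O'.
  apply: openI => //; apply: (@open_comp _ _ (fun w : V => (w *m u) 0 0)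
    [set x | x != 0]); last exact: open_neq.
  by move=> w _; exact: mulmx_row_continuous.
have O'0 : O' !=set0.
  have [vu|vu] := eqVneq ((v *m u) 0 0) 0; last by exists v.
  have uu : (u^T *m u) 0 0 != 0.
    apply: contra u0; rewrite mxE psumr_eq0 => [/allP u0|j _]; last first.
      by rewrite mxE -expr2 sqr_ge0.
    apply/eqP/colP => j; have := u0 j; rewrite mem_index_enum mxE => /(_ isT).
    by rewrite mulf_eq0 orbb mxE => /eqP.
  have : \forall t \near (0 : R)^', O (v + t *: u^T).
    have cl : (fun t : R => v + t *: u^T) @ (0 : R) --> v + 0 *: u^T.
      by rewrite -[_ --> _]/(continuous_at 0 _); continuity.
    rewrite scale0r addr0 in cl.
    by apply: cvg_within; apply: cl; exact: open_nbhs_nbhs.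
  move=> nO; near (0 : R)^' => t.
  exists (v + t *: u^T); split; first by near: t.
  rewrite /= mulmxDl -scalemxAl mxE vu add0r mxE mulf_neq0//.
  by near: t; exact: nbhs_dnbhs_neq.
have [|w [Ow wu] ws] := IH O' _ oO' O'0.
  by move=> z zs; apply: s0; rewrite inE zs orbT.
by exists w => // z; rewrite inE => /predU1P[->//|/ws].
Unshelve. all: by end_near. Qed.

(** Three vectors span at most dimension 3, less than [n.+4]; this is where the dimension bound
    enters. *)
Lemma exists_annihilator (x w e : V) :
  exists u : 'cV[R]_n.+4, [/\ u != 0, x *m u = 0, w *m u = 0 & e *m u = 0].
Proof.
pose M := col_mx x (col_mx w e).
have : kermx M^T != 0.
  rewrite -mxrank_eq0 mxrank_ker subn_eq0 -ltnNge.
  by rewrite (leq_ltn_trans (rank_leq_col _)).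
move=> /rowV0Pn[v /sub_kermxP vM v0]; exists v^T.
have : M *m v^T = 0 by apply: trmx_inj; rewrite trmx_mul trmxK trmx0.
rewrite /M !mul_col_mx -[in RHS]col_mx0 => /eq_col_mx[xv].
rewrite -[in RHS]col_mx0 => /eq_col_mx[wv ev]; split => //.
by rewrite -(inj_eq (@trmx_inj _ _ _)) trmxK trmx0.
Qed.

(** Each span of [x], [w] and some [e] lies in the hyperplane of an annihilator, so finitely many
    hyperplanes have to be avoided. *)
Lemma open_avoid_spans (x w : V) (es : seq V) (O : set V) :
  open O -> O !=set0 ->
  exists2 v, O v & {in es, forall e a b c, v <> a *: x + b *: w + c *: e}.
Proof.
move=> oO O0; have [u uP] := choice (exists_annihilator x w).
have [|v Ov vP] := @open_avoid_hyperplanes (map u es) O _ oO O0.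
  by move=> _ /mapP[e _ ->]; have [] := uP e.
exists v => // e ees a b c vE; have [_ xu wu eu] := uP e.
have /eqP[] := vP _ (map_f u ees).
by rewrite vE !mulmxDl -!scalemxAl xu wu eu !scaler0 !addr0 mxE.
Qed.

End GeneralPosition.

Section Clamp.
Variable R : realType.

(* Precomposing with [clamp] turns functions on [0, 1] into globally continuous
   functions with the same values there. *)
Definition clamp (t : R) : R := Num.max 0 (Num.min 1 t).

Lemma clamp_itv t : 0 <= clamp t <= 1.
Proof. by rewrite /clamp le_max lexx/= ge_max ler01/= ge_min lexx. Qed.

Lemma clamp_id t : 0 <= t <= 1 -> clamp t = t.
Proof. by move=> /andP[t0 t1]; rewrite /clamp min_r// max_r. Qed.

Lemma clamp_le0 t : t <= 0 -> clamp t = 0.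
Proof.
by move=> t0; rewrite /clamp min_r ?max_l// (le_trans t0).
Qed.

Lemma clamp_ge1 t : 1 <= t -> clamp t = 1.
Proof. by move=> t1; rewrite /clamp min_l// max_r. Qed.

Lemma clamp0 : clamp 0 = 0.
Proof. by rewrite clamp_le0. Qed.

Lemma clamp1 : clamp 1 = 1.
Proof. by rewrite clamp_ge1. Qed.

Lemma clamp_continuous : continuous clamp.
Proof.
by move=> t; rewrite /clamp; continuity.
Qed.

End Clamp.

Section Polygon.
Variables (R : realType) (V : normedModType R).

(** The piecewise linear path through [v 0], ..., [v N] at equally spaced times. Each increment is
    switched on by [clamp] during its own step, so a single formula gives continuity without
    gluing. *)
Definition polygon (N : nat) (v : nat -> V) (t : R) : V :=
  v 0%N + \sum_(0 <= j < N) clamp (N%:R * t - j%:R) *: (v j.+1 - v j).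

Lemma polygon_continuous N v : continuous (polygon N v).
Proof.
move=> t; rewrite /polygon; continuity.
apply: (continuous_at_comp (g := @clamp R)); last exact: clamp_continuous.
by continuity.
Qed.

(** On step [k] the earlier increments are complete and telescope to [v k], while the later ones are
    still zero. *)
Lemma polygonE N v k u t : (k < N)%N -> 0 <= u <= 1 -> N%:R * t = k%:R + u ->
  polygon N v t = (1 - u) *: v k + u *: v k.+1.
Proof.
move=> kN /andP[u0 u1] tE; rewrite /polygon.
rewrite (big_cat_nat (leq0n k) (ltnW kN))/= tE (big_ltn kN).
rewrite addrA (eq_big_nat _ _ (F2 := fun j => v j.+1 - v j)); last first.
  move=> j /= jk; rewrite clamp_ge1 ?scale1r//.
  rewrite addrAC -natrB ?(ltnW jk)//.
  by rewrite (@le_trans _ _ (k - j)%:R) ?lerDl// ler1n subn_gt0.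
rewrite telescope_sumr// big_nat big1 => [|j /andP[kj _]]; last first.
  rewrite clamp_le0 ?scale0r// subr_le0.
  by rewrite (le_trans (lerD (lexx _) u1))// natr1 ler_nat.
rewrite addr0 [k%:R + u - _]addrAC subrr add0r clamp_id ?u0//.
rewrite addrA [v 0%N + _]addrC subrK scalerBr scalerBl scale1r.
by rewrite addrA addrAC.
Qed.

Lemma polygon0 N v : polygon N v 0 = v 0%N.
Proof.
rewrite /polygon big1 ?addr0// => j _.
by rewrite mulr0 sub0r clamp_le0 ?scale0r// oppr_le0.
Qed.

Lemma polygon1 N v : polygon N v 1 = v N.
Proof.
case: N => [|N]; first by rewrite /polygon big_geq// addr0.
rewrite (@polygonE _ _ N 1) ?lexx ?ler01//; first by rewrite subrr scale0r add0r scale1r.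
by rewrite mulr1 natr1.
Qed.

End Polygon.

(** * Contracting loops in the complement of finitely many lines *)

Section ComplementOfLines.
Variables (R : realType) (n : nat).
Local Notation V := 'rV[R]_n.+4.
Variables (K : set V) (es : seq V).
Hypothesis closedK : closed K.
Hypothesis K_lines : forall v, K v -> exists2 e, e \in es & exists a, v = a *: e.

(** Each point of the path has a ball missing the closed set [K]; compactness of [0, 1] makes the
    radius uniform. *)
Lemma path_margin (gamma : R -> V) :
  continuous gamma -> (forall t, ~ K (gamma t)) ->
  exists2 eps : R, 0 < eps &
    forall t : R, 0 <= t <= 1 -> forall v : V, `|gamma t - v| < eps -> ~ K v.
Proof.
move=> cg gK.
have /compact_near_coveringP/(_ R (0^'+)
    (fun (eps t : R) => forall v : V, `|gamma t - v| < eps -> ~ K v)) :=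
  @segment_compact R 0 1.
have cv (t : R) : `[0, 1]%classic t -> \forall t' \near t & eps \near (0:R)^'+,
    forall v : V, `|gamma t' - v| < eps -> ~ K v.
  move=> _.
  have /nbhs_normP[d /= d0 dK] : nbhs (gamma t) (~` K).
    by apply: open_nbhs_nbhs; split; [exact: closed_openC|exact: gK].
  near=> t' eps => /= v v'; apply: dK => /=.
  rewrite -(subrKA (gamma t')) (splitr d) (le_lt_trans (ler_normD _ _))//.
  rewrite ltrD//.
    by near: t'; move/cvgrPdist_lt : (cg t); apply; rewrite divr_gt0.
  apply: (lt_trans v').
  by near: eps; apply: nbhs_right_lt; rewrite divr_gt0.
move=> covP.
have H := covP (@filter_filter R _ (at_right_proper_filter 0)) cv.
have [eps [epsP eps0]] :=
  @filter_ex _ _ (at_right_proper_filter (0:R)) _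
    (filterI H (nbhs_right_gt 0)).
by exists eps => // t t01; apply: epsP; rewrite /= in_itv.
Unshelve. all: by end_near. Qed.

(** Uniform continuity on [0, 1], with a modulus of the form 1/N so that [N] can serve as the number
    of edges of a polygon. *)
Lemma path_uniform (gamma : R -> V) (e : R) : continuous gamma -> 0 < e ->
  exists2 N : nat, (0 < N)%N &
    forall t t' : R, 0 <= t <= 1 -> `|t - t'| <= N%:R^-1 ->
      `|gamma t - gamma t'| < e.
Proof.
move=> cg e0.
have /compact_near_coveringP/(_ R (0^'+)
    (fun d t : R => forall t' : R, `|t - t'| <= d -> `|gamma t - gamma t'| < e)) :=
  @segment_compact R 0 1.
have cv (t : R) : `[0, 1]%classic t -> \forall t' \near t & d \near (0:R)^'+,
    forall t'' : R, `|t' - t''| <= d -> `|gamma t' - gamma t''| < e.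
  move=> _.
  have /nbhs_normP[d /= d0 dg] : nbhs t [set x | `|gamma t - gamma x| < e / 2].
    by move/cvgrPdist_lt : (cg t); apply; rewrite divr_gt0.
  near=> t' d' => /= t'' t't''.
  rewrite -(subrKA (gamma t)) (splitr e) (le_lt_trans (ler_normD _ _))//.
  rewrite ltrD//.
    by rewrite distrC; apply: dg => /=; near: t';
      apply: (@cvgr_dist_lt _ _ _ _ _ id t) => //.
  apply: dg => /=; rewrite -(subrKA t') (splitr d).
  rewrite (le_lt_trans (ler_normD _ _))// ltrD//.
    by near: t'; apply: (@cvgr_dist_lt _ _ _ _ _ id t) => //; rewrite divr_gt0.
  apply: (le_lt_trans t't'').
  by near: d'; apply: nbhs_right_lt; rewrite divr_gt0.
move=> covP.
have H := covP (@filter_filter R _ (at_right_proper_filter 0)) cv.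
have [d [dP d0]] :=
  @filter_ex _ _ (at_right_proper_filter (0:R)) _
    (filterI H (nbhs_right_gt 0)).
pose N := (Num.truncn d^-1).+1.
exists N => // t t' t01 tt'.
have : `|t - t'| <= d.
  rewrite (le_trans tt')// -[leRHS]invrK lef_pV2 ?posrE ?invr_gt0 ?ltr0n//.
  by rewrite ltW// truncnS_gt.
by apply: dP; rewrite /= in_itv.
Unshelve. all: by end_near. Qed.

(** A point of the triangle that lies on the line of some [e] gives a linear relation. Solving it
    for [w], or for [v] when the coefficient of [w] vanishes, contradicts general position. The
    alternatives [v = x] and [w = x] cover the first and last edges, over which the cone degenerates
    to a segment. *)
Lemma cone_off_lines (x v w : V) (a b : R) :
  ~ K x ->
  (v = x \/ {in es, forall e a b, v <> a *: x + b *: e}) ->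
  (w = x \/ {in es, forall e a b c, w <> a *: x + b *: v + c *: e}) ->
  ~ K (b *: x + (1 - b) *: ((1 - a) *: v + a *: w)).
Proof.
move=> xK vP wP /[dup] Kp /K_lines[e ees [l pE]].
have [b1|b1] := eqVneq b 1.
  by move: Kp; rewrite b1 subrr scale0r addr0 scale1r.
have b10 : 1 - b != 0 by rewrite subr_eq0 eq_sym.
have segm c : ~ K (c *: x + (1 - c) *: v).
  case: vP => [->|vP]; first by rewrite -scalerDl addrC subrK scale1r.
  have [->|c1] := eqVneq c 1.
    by rewrite subrr scale0r addr0 scale1r.
  have c10 : 1 - c != 0 by rewrite subr_eq0 eq_sym.
  move=> /K_lines[e' e'es [l' qE]].
  apply: (vP _ e'es (- (1 - c)^-1 * c) ((1 - c)^-1 * l')).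
  apply/rowP => j; have := congr1 (fun u : V => u 0 j) qE; rewrite !mxE.
  by rewrite -[_ * l' * _]mulrA => <-; field.
have [a0|a0] := eqVneq a 0.
  by apply: (segm b); move: Kp; rewrite a0 subr0 scale1r scale0r addr0.
case: wP => [wx|wP].
  apply: (segm (b + (1 - b) * a)); move: Kp; rewrite wx; congr K.
  rewrite scalerDr !scalerA [X in _ + X]addrC addrA -scalerDl; congr (_ + _ *: _).
  by ring.
have ba0 : (1 - b) * a != 0 by rewrite mulf_neq0.
apply: (wP _ ees (- ((1 - b) * a)^-1 * b) (- ((1 - b) * a)^-1 * ((1 - b) * (1 - a)))
  (((1 - b) * a)^-1 * l)).
apply/rowP => j; have := congr1 (fun u : V => u 0 j) pE; rewrite !mxE.
by rewrite -[_ * l * _]mulrA => <-; field; rewrite a0.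
Qed.

(** Paths and homotopies are built by linear formulas in [V] and returned to [X] by [r], whose
    continuity is asked only off [K]. Replacing a loop by a polygon leaves finitely many vertices to
    put in general position. *)
Lemma simply_connected_off_lines (X : topologicalType) (i : X -> V)
    (r : V -> X) (x0 : X) :
  continuous i -> (forall v, ~ K v -> {for v, continuous r}) -> cancel i r ->
  (forall x, ~ K (i x)) -> simply_connected R X.
Proof.
move=> ci cr iK iNK; split.
  split; first by exists x0.
  move=> x y.
  have [|w _ wP] := @open_avoid_spans R n (i x) (i y) es setT openT.
    by exists 0.
  (* The quadratic term, in a direction [w] outside the spans of [i x], [i y] and
     the lines, keeps the path off the lines without subdividing it. *)
  pose c (t : R) := (1 - t) *: i x + t *: i y + (t * (1 - t)) *: w.
  have cNK t : ~ K (c t).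
    have [t0|t0] := eqVneq (t * (1 - t)) 0.
      rewrite /c t0 scale0r addr0.
      move/eqP: t0; rewrite mulf_eq0 subr_eq0 => /predU1P[->|/eqP <-].
        by rewrite subr0 scale1r scale0r addr0.
      by rewrite subrr scale0r scale1r add0r.
    move=> /K_lines[e ees [l cE]].
    apply: (wP e ees (- (t * (1 - t))^-1 * (1 - t)) (- (t * (1 - t))^-1 * t)
       ((t * (1 - t))^-1 * l)).
    apply/rowP => j; have := congr1 (fun u : V => u 0 j) cE; rewrite !mxE.
    rewrite -[_ * l * _]mulrA => <-; field.
    by move: t0; rewrite mulf_eq0 negb_or andbC.
  exists (r \o c); split.
  - apply: within_continuous_postcomp => [|t _]; last exact: cr.
    by apply: continuous_subspaceT => t; rewrite /c; continuity.
  - by rewrite /= /c subr0 scale1r !scale0r mul0r scale0r !addr0.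
  - by rewrite /= /c subrr mulr0 !scale0r scale1r add0r addr0.
move=> x c [cc c0 c1].
(* Extended by its end values, the loop is continuous on all of [R]. *)
pose gamma := i \o (c \o @clamp R).
have cgamma : continuous gamma.
  move=> t; apply: continuous_comp; last exact: ci.
  have /within_continuousT cc' := cc.
  have t01 s : `[0, 1]%classic (@clamp R s) by rewrite /= in_itv/= clamp_itv.
  move=> U nU; have := @clamp_continuous R t _ (cc' _ (t01 t) U nU).
  apply: (@filterS _ (nbhs t)) => s.
  by apply; exact: t01.
have [eps eps0 epsP] := path_margin cgamma (fun t => @iNK _).
(* One quarter of the margin bounds the oscillation over an edge and another the displacement of a
   vertex, so the polygon stays within [eps / 2] of the loop. *)
have e40 : 0 < eps / 4 by rewrite divr_gt0.
have [N N0 NP] := path_uniform cgamma e40.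
have NR : N%:R != 0 :> R by rewrite pnatr_eq0 -lt0n.
(* The pair [p] holds the previous vertex and the point of the loop to approximate. *)
have /choice[next nextP] : forall p : V * V, exists v : V,
    `|p.2 - v| < eps / 4 /\
    {in es, forall e a b c, v <> a *: i x + b *: p.1 + c *: e}.
  move=> [w y] /=.
  have [| |v yv vP] :=
    @open_avoid_spans R n (i x) w es [set v | `|y - v| < eps / 4].
  - suff -> : [set v | `|y - v| < eps / 4] = ball y (eps / 4).
      by apply: ball_open.
    by rewrite -ball_normE.
  - by exists y; rewrite /= subrr normr0.
  - by exists v.
pose v0 := fix v0 k := if k is k'.+1
  then next (v0 k', gamma (k%:R / N%:R)) else i x.
(* The last vertex is reset to the base point so that the polygon closes up. *)
pose v k := if k == N then i x else v0 k.
have gamma0 : gamma 0 = i x by rewrite /gamma /= clamp0 c0.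
have gamma1 : gamma 1 = i x by rewrite /gamma /= clamp1 c1.
have v_near k : `|gamma (k%:R / N%:R) - v k| < eps / 4.
  rewrite /v; case: eqP => [->|_].
    by rewrite divff// gamma1 subrr normr0.
  case: k => [|k]; first by rewrite mul0r gamma0 subrr normr0.
  by have [] := nextP (v0 k, gamma (k.+1%:R / N%:R)).
have vx k : v k = i x \/ {in es, forall e a b, v k <> a *: i x + b *: e}.
  rewrite /v; case: eqP => _; first by left.
  case: k => [|k]; first by left.
  right=> e ees a b.
  have [_ /(_ e ees a 0 b)] := nextP (v0 k, gamma (k.+1%:R / N%:R)).
  by rewrite scale0r addr0.
have vv k : (k < N)%N -> v k.+1 = i x \/
    {in es, forall e a b c, v k.+1 <> a *: i x + b *: v k + c *: e}.
  move=> kN; have [kE|kE] := eqVneq k.+1 N; first by left; rewrite /v kE eqxx.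
  right=> e ees a b d; rewrite /v (negbTE kE) (ltn_eqF kN).
  by have [_ /(_ e ees a b d)] := nextP (v0 k, gamma (k.+1%:R / N%:R)).
pose poly := polygon N v.
have poly_seg t : 0 <= t <= 1 -> exists k u, [/\ (k < N)%N, 0 <= u <= 1,
    t = (k%:R + u) / N%:R & poly t = (1 - u) *: v k + u *: v k.+1].
  (* At [t = 1] truncation would return [N], which indexes no edge; the end of the last edge is
     taken instead. *)
  move=> /andP[t0 t1]; have [t1'|t1'] := eqVneq t 1.
    exists N.-1, 1; rewrite prednK// leqnn ler01 lexx.
    rewrite natr1 prednK// divff// t1'; split => //.
    by rewrite /poly polygon1 subrr scale0r scale1r add0r.
  have Nt0 : 0 <= N%:R * t by rewrite mulr_ge0.
  have /andP[kt tk] := truncn_itv Nt0.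
  set k := Num.truncn _ in kt tk; exists k, (N%:R * t - k%:R).
  have kN : (k < N)%N.
    rewrite -(ltr_nat R) (le_lt_trans kt)// -[ltRHS]mulr1 ltr_pM2l ?ltr0n//.
    by rewrite lt_neqAle t1'.
  have u01 : 0 <= N%:R * t - k%:R <= 1.
    by rewrite subr_ge0 kt/= lerBlDl natr1 ltW.
  split => //.
    by rewrite addrC subrK mulrC mulKf.
  by apply: polygonE => //; rewrite addrC subrK.
have poly_near t : 0 <= t <= 1 -> `|gamma t - poly t| < eps / 2.
  move=> t01; have [k [u [kN /andP[u0 u1] tE ->]]] := poly_seg t t01.
  have gk j : `|t - j%:R / N%:R| <= N%:R^-1 -> `|gamma t - v j| < eps / 2.
    move=> tj; rewrite -(subrKA (gamma (j%:R / N%:R))).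
    rewrite (le_lt_trans (ler_normD _ _))//.
    have -> : eps / 2 = eps / 4 + eps / 4 by field.
    by rewrite ltrD// NP.
  have N0' : 0 < N%:R^-1 :> R by rewrite invr_gt0 ltr0n.
  have gk0 : `|gamma t - v k| < eps / 2.
    apply: gk; rewrite tE -mulrBl [k%:R + _]addrC addrK normrM ger0_norm//.
    by rewrite gtr0_norm// ler_piMl// ltW.
  have gk1 : `|gamma t - v k.+1| < eps / 2.
    apply: gk; rewrite tE -mulrBl -natr1 normrM (gtr0_norm N0').
    rewrite opprD addrACA subrr add0r distrC ger0_norm ?subr_ge0//.
    by rewrite ler_piMl ?(ltW N0')// lerBlDl lerDr.
  have -> : gamma t - ((1 - u) *: v k + u *: v k.+1) =
      (1 - u) *: (gamma t - v k) + u *: (gamma t - v k.+1).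
    by rewrite !scalerBr addrACA -opprD -scalerDl subrK scale1r.
  rewrite (le_lt_trans (ler_normD _ _))// !normrZ (ger0_norm u0).
  rewrite ger0_norm ?subr_ge0//.
  have [->|u00] := eqVneq u 0; first by rewrite subr0 mul1r mul0r addr0.
  have -> : eps / 2 = (1 - u) * (eps / 2) + u * (eps / 2).
    by rewrite -mulrDl subrK mul1r.
  apply: ler_ltD; first by rewrite ler_wpM2l ?subr_ge0// ltW.
  by rewrite ltr_pM2l// lt_neqAle eq_sym u00.
(* For [s <= 1/2] the loop is pushed onto the polygon, then the polygon is
   contracted along segments to its base point. *)
pose H (p : R * R) : V :=
  let a := clamp (2 * p.1) in let b := clamp (2 * p.1 - 1) in
  b *: i x + (1 - b) *: ((1 - a) *: gamma p.2 + a *: poly p.2).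
have cH : continuous H.
  move=> p; rewrite /H.
  have ca : continuous_at p (fun p : R * R => clamp (2 * p.1)).
    apply: (continuous_at_comp (g := @clamp R)); last exact: clamp_continuous.
    by continuity.
  have cb : continuous_at p (fun p : R * R => clamp (2 * p.1 - 1)).
    apply: (continuous_at_comp (g := @clamp R)); last exact: clamp_continuous.
    by continuity.
  have cga : continuous_at p (fun p : R * R => gamma p.2).
    by apply: (continuous_at_comp (g := gamma)); [continuity|exact: cgamma].
  have cpo : continuous_at p (fun p : R * R => poly p.2).
    apply: (continuous_at_comp (g := poly)); first by continuity.
    exact: polygon_continuous.
  by continuity.
have HNK s t : 0 <= t <= 1 -> ~ K (H (s, t)).
  move=> t01; rewrite /H /=.
  have [b0|b0] := leP (2 * s - 1) 0.
    rewrite (clamp_le0 b0) scale0r add0r subr0 scale1r; apply: (epsP t t01).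
    set a := clamp _; have /andP[a0 a1] : 0 <= a <= 1 by exact: clamp_itv.
    have -> : gamma t - ((1 - a) *: gamma t + a *: poly t) =
        a *: (gamma t - poly t).
      by rewrite scalerBl scale1r opprD opprB addrA addrCA subrr addr0 -scalerBr.
    rewrite normrZ (ger0_norm a0) (@le_lt_trans _ _ `|gamma t - poly t|)//.
      by rewrite ler_piMl.
    by rewrite (lt_trans (poly_near _ t01))// ltr_pdivrMr// ltr_pMr// ltr1n.
  have -> : clamp (2 * s) = 1 by rewrite clamp_ge1// ltW// -subr_gt0.
  rewrite subrr scale0r add0r scale1r.
  have [k [u [kN u01 _ ->]]] := poly_seg t t01.
  by apply: cone_off_lines => //; exact: vv.
exists (r \o H); split.
- apply: within_continuous_postcomp; first exact: continuous_subspaceT.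
  by move=> [s t] [_ /= t01]; apply: cr; apply: HNK; rewrite in_itv in t01.
- move=> t; rewrite in_itv/= => t01.
  rewrite /H/= mulr0 clamp0 sub0r clamp_le0 ?oppr_le0//.
  rewrite !scale0r add0r subr0 !scale1r addr0 /gamma/= clamp_id//.
- move=> t _; rewrite /H /= mulr1 addrK clamp1 subrr scale0r addr0 scale1r.
  exact: iK.
- move=> s _; rewrite /H/= /poly polygon0 gamma0 /v.
  rewrite (ltn_eqF N0)/= -scalerDl subrK scale1r -scalerDl addrC subrK scale1r.
  exact: iK.
- move=> s _; rewrite /H/= /poly polygon1 gamma1 /v eqxx.
  rewrite -scalerDl subrK scale1r -scalerDl addrC subrK scale1r.
  exact: iK.
Qed.

End ComplementOfLines.

(** * The complex plane and the three-sphere *)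

Section ComplexAlgebra.
Variable R : realType.

Lemma ReM (z w : R[i]) : Re (z * w) = Re z * Re w - Im z * Im w.
Proof. by case: z w => a b [c d]. Qed.

Lemma ImM (z w : R[i]) : Im (z * w) = Re z * Im w + Im z * Re w.
Proof. by case: z w => a b [c d]. Qed.

Lemma ReD (z w : R[i]) : Re (z + w) = Re z + Re w.
Proof. by case: z w => a b [c d]. Qed.

Lemma ImD (z w : R[i]) : Im (z + w) = Im z + Im w.
Proof. by case: z w => a b [c d]. Qed.

Lemma ReN (z : R[i]) : Re (- z) = - Re z.
Proof. by case: z. Qed.

Lemma ImN (z : R[i]) : Im (- z) = - Im z.
Proof. by case: z. Qed.

Lemma ReJ (z : R[i]) : Re z^* = Re z.
Proof. by case: z. Qed.

Lemma ImJ (z : R[i]) : Im z^* = - Im z.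
Proof. by case: z. Qed.

Definition ReImE := (ReM, ImM, ReD, ImD, ReN, ImN, ReJ, ImJ).

Lemma complex_ext (z w : R[i]) : Re z = Re w -> Im z = Im w -> z = w.
Proof. by case: z w => a b [c d] /= -> ->. Qed.

(** The squared modulus as an element of [R], where order and ring reasoning apply; the norm of
    [R[i]] takes its values in [R[i]]. *)
Definition normsq (z : R[i]) : R := Re z ^+ 2 + Im z ^+ 2.

Lemma normsq_ge0 z : 0 <= normsq z.
Proof. by rewrite addr_ge0 ?sqr_ge0. Qed.

Lemma normsq_eq0 z : (normsq z == 0) = (z == 0).
Proof.
by rewrite paddr_eq0 ?sqr_ge0// !sqrf_eq0 eq_complex.
Qed.

Lemma normsqM z w : normsq (z * w) = normsq z * normsq w.
Proof. by rewrite /normsq !ReImE; ring. Qed.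

End ComplexAlgebra.

Section ComplexTopology.
Variable R : realType.
Local Notation C := (R[i]^o).

Lemma nbhs_complex_ball (x : C) (e : R) : 0 < e ->
  \forall y \near x, `|x - y| < e%:C.
Proof.
move=> e0; have eC0 : 0 < e%:C :> R[i] by rewrite ltcR.
by apply/nbhs_normP; exists e%:C.
Qed.

Lemma Re_continuous : continuous (@complex.Re R : C -> R).
Proof.
move=> x U /nbhs_normP[e /= e0 eU].
apply: (@filterS _ _ (nbhs_filter (x : C)) _ _ _ (nbhs_complex_ball x e0)) => y /= xy.
apply: eU; rewrite /= -ltcR (le_lt_trans _ xy)//.
have := normc_ge_Re (x - y); congr (`|_|%:C <= _).
by case: x {xy} => a b; case: y => c d.
Qed.

Lemma Im_continuous : continuous (@complex.Im R : C -> R).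
Proof.
move=> x U /nbhs_normP[e /= e0 eU].
apply: (@filterS _ _ (nbhs_filter (x : C)) _ _ _ (nbhs_complex_ball x e0)) => y /= xy.
apply: eU; rewrite /= -ltcR (le_lt_trans _ xy)//.
have := normc_ge_Re ('i * (x - y)); rewrite normrM.
have -> : `|'i%C : R[i]| = 1 by rewrite normc_def/= expr0n/= add0r expr1n sqrtr1.
rewrite mul1r; congr (_ <= _); rewrite mulrC ReiNIm normrN.
by case: x {xy} => a b; case: y => c d.
Qed.

Section At.
Variables (T : topologicalType) (x : T).

Lemma continuous_at_Re (f : T -> C) :
  continuous_at x f -> continuous_at x (fun t => Re (f t)).
Proof. by move=> cf; apply: continuous_comp => //; exact: Re_continuous. Qed.

Lemma continuous_at_Im (f : T -> C) :
  continuous_at x f -> continuous_at x (fun t => Im (f t)).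
Proof. by move=> cf; apply: continuous_comp => //; exact: Im_continuous. Qed.

Lemma continuous_at_complex (f : T -> C) :
  continuous_at x (fun t => Re (f t)) -> continuous_at x (fun t => Im (f t)) ->
  continuous_at x f.
Proof.
move=> cre cim; apply/cvgrPdist_lt => e e0.
(* Radii of balls in [C] are elements of [R[i]]; a positive one is real. *)
have [r eE] : exists r : R, e = r%:C by apply/complex_realP; exact: gtr0_real.
move: e0; rewrite {}eE ltcR => r0.
have r20 : 0 < r / 2 by rewrite divr_gt0.
move/cvgrPdist_lt : cre => /(_ _ r20); move/cvgrPdist_lt : cim => /(_ _ r20).
apply: filterS2 => t ti tr.
have -> : f x - f t = (Re (f x) - Re (f t))%:C + 'i * (Im (f x) - Im (f t))%:C.
  rewrite [LHS]complexE; congr (_%:C + _ * _%:C).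
    by case: (f x) => a b; case: (f t) => c d.
  by case: (f x) => a b; case: (f t) => c d.
rewrite (le_lt_trans (ler_normD _ _))// normrM.
have -> : `|'i%C : R[i]| = 1 by rewrite normc_def/= expr0n/= add0r expr1n sqrtr1.
rewrite mul1r !normc_def/= expr0n/= !addr0 !sqrtr_sqr -rmorphD/= ltcR.
by rewrite (splitr r) ltrD.
Qed.

(** [C] is normed over [R[i]], not over [R], so this and the next operations are reduced to real and
    imaginary parts. *)
Lemma continuous_at_complexD (f g : T -> C) :
  continuous_at x f -> continuous_at x g ->
  continuous_at x (fun t => f t + g t : C).
Proof.
move=> cf cg; apply: continuous_at_complex.
  have -> : (fun t => Re (f t + g t)) = fun t => Re (f t) + Re (g t).
    by apply/funext => t; rewrite ReD.
  by continuity; exact: continuous_at_Re.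
have -> : (fun t => Im (f t + g t)) = fun t => Im (f t) + Im (g t).
  by apply/funext => t; rewrite ImD.
by continuity; exact: continuous_at_Im.
Qed.

Lemma continuous_at_complexN (f : T -> C) :
  continuous_at x f -> continuous_at x (fun t => - f t : C).
Proof.
move=> cf; apply: continuous_at_complex.
  have -> : (fun t => Re (- f t)) = fun t => - Re (f t).
    by apply/funext => t; rewrite ReN.
  by continuity; exact: continuous_at_Re.
have -> : (fun t => Im (- f t)) = fun t => - Im (f t).
  by apply/funext => t; rewrite ImN.
by continuity; exact: continuous_at_Im.
Qed.

Lemma continuous_at_conjc (f : T -> C) :
  continuous_at x f -> continuous_at x (fun t => (f t)^* : C).
Proof.
move=> cf; apply: continuous_at_complex.
  have -> : (fun t => Re (f t)^*) = fun t => Re (f t).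
    by apply/funext => t; rewrite ReJ.
  exact: continuous_at_Re.
have -> : (fun t => Im (f t)^*) = fun t => - Im (f t).
  by apply/funext => t; rewrite ImJ.
by continuity; exact: continuous_at_Im.
Qed.

Lemma continuous_at_complexM (f g : T -> C) :
  continuous_at x f -> continuous_at x g ->
  continuous_at x (fun t => f t * g t : C).
Proof.
move=> cf cg; apply: continuous_at_complex.
  have -> : (fun t => Re (f t * g t)) =
      fun t => Re (f t) * Re (g t) - Im (f t) * Im (g t).
    by apply/funext => t; rewrite ReM.
  by continuity; (exact: continuous_at_Re || exact: continuous_at_Im).
have -> : (fun t => Im (f t * g t)) =
    fun t => Re (f t) * Im (g t) + Im (f t) * Re (g t).
  by apply/funext => t; rewrite ImM.
by continuity; (exact: continuous_at_Re || exact: continuous_at_Im).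
Qed.

Lemma continuous_at_realC (f : T -> R) :
  continuous_at x f -> continuous_at x (fun t => (f t)%:C : C).
Proof.
by move=> cf; apply: continuous_at_complex => //=; exact: continuous_at_cst.
Qed.

Lemma continuous_at_normsq (f : T -> C) :
  continuous_at x f -> continuous_at x (fun t => normsq (f t)).
Proof.
move=> cf; rewrite /normsq.
by continuity; (exact: continuous_at_Re || exact: continuous_at_Im).
Qed.

End At.

End ComplexTopology.

Section Sphere.
Variable R : realType.
Local Notation C := (R[i]^o).

Lemma S3_setP (x : C * C) : S3_set x <-> normsq x.1 + normsq x.2 = 1.
Proof.
rewrite /S3_set /= -!add_Re2_Im2 -rmorphD/=.
by split=> [/complexI//|->].
Qed.

Lemma S3_normsq (x : S3 R) : normsq (\val x).1 + normsq (\val x).2 = 1.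
Proof. by apply/S3_setP; exact/set_mem/valP. Qed.

Definition mkS3 (x : C * C) (xS : S3_set x) : S3 R := exist _ x (mem_set xS).

End Sphere.

Ltac complex_continuity :=
  repeat first
  [ match goal with
    | |- continuous_at _ (fun t => Re _) => apply: continuous_at_Re
    | |- continuous_at _ (fun t => Im _) => apply: continuous_at_Im
    | |- continuous_at _ (fun t => real_complex _ _) => apply: continuous_at_realC
    | |- continuous_at _ (fun t => normsq _) => apply: continuous_at_normsq
    | |- continuous_at _ (fun t => Num.conj _) => apply: continuous_at_conjc
    | |- continuous_at _ (fun t => _ + _) => apply: continuous_at_complexD
    | |- continuous_at _ (fun t => - _) => apply: continuous_at_complexN
    | |- continuous_at _ (fun t => _ * _) => apply: continuous_at_complexM
    | |- continuous_at _ ( *%R ?a) =>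
        apply: (continuous_at_complexM (f := fun=> a) (g := fun t => t))
    | |- continuous_at _ (fun t => (_, _)) => apply: continuous_at_pair
    | |- continuous_at _ (fun t => fst _) =>
        apply: (continuous_at_comp (g := fst)); last exact: cvg_fst
    | |- continuous_at _ (fun t => snd _) =>
        apply: (continuous_at_comp (g := snd)); last exact: cvg_snd
    end
  | progress continuity
  | exact: set_val_continuous
  | apply: continuous_at_val ].

Section Rotation.
Variable R : realType.
Local Notation C := (R[i]^o).

Lemma zeta7X k : zeta7 R ^+ k =
  cos (2 * pi / 7 *+ k) +i* sin (2 * pi / 7 *+ k).
Proof. exact: cos_sin_natmul. Qed.

Lemma normsq_zeta7X k : normsq (zeta7 R ^+ k) = 1.
Proof. by rewrite zeta7X /normsq/= cos2Dsin2. Qed.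

(** By the double angle formula the real part is 1 - 2 s^2 with s the sine of k pi / 7, an angle
    strictly between 0 and pi. *)
Lemma zeta7X_neq1 k : (0 < k < 7)%N -> zeta7 R ^+ k != 1.
Proof.
move=> /andP[k0 k7]; rewrite zeta7X eq_complex/= negb_and; apply/orP; left.
have -> : 2 * pi / 7 *+ k = (pi *+ k / 7 *+ 2) :> R.
  rewrite -[2 * pi / 7 *+ k]mulr_natr -[pi *+ k]mulr_natr -[_ *+ 2]mulr_natr.
  by ring.
rewrite cos_mulr2n cos2sin2.
have : 0 < sin (pi *+ k / 7 : R).
  have p0 := pi_gt0 R.
  apply: sin_gt0_pi; rewrite -[pi *+ k]mulr_natr divr_gt0 ?mulr_gt0 ?ltr0n//=.
  by rewrite ltr_pdivrMr// ltr_pM2l// ltr_nat.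
move=> s0; apply/eqP => E; have : sin (pi *+ k / 7) ^+ 2 = 0 :> R by lra.
by move/eqP; rewrite sqrf_eq0 gt_eqF.
Qed.

Lemma rot7_continuous k : continuous (@rot7 R k).
Proof.
move=> x; rewrite /rot7; complex_continuity.
Qed.

End Rotation.

(** * The covering *)

Section FreeAction.
Variables (E B : topologicalType) (p : E -> B) (I : Type).
Variables (g h : I -> E -> E) (i0 : I).
Hypothesis p_continuous : continuous p.
Hypothesis p_surj : range p = [set: B].
Hypothesis p_open : forall O, open O -> open (p @` O).
Hypothesis h_continuous : forall i, continuous (h i).
Hypothesis hK : forall i, cancel (h i) (g i).
Hypothesis gK : forall i, cancel (g i) (h i).
Hypothesis g_id : forall e, g i0 e = e.
Hypothesis p_fiber : forall x y, p x = p y <-> exists i, x = g i y.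
Hypothesis g_free : forall e, exists2 V, open V & V e /\
  forall i j x y, V x -> V y -> g i x = g j y -> i = j.

(** The sheets over the image of [V] are its translates, written as preimages under the inverses
    [h i] so that they are open. [g_free] makes them disjoint and, by comparison with the identity
    [i0], makes [p] injective on each. *)
Lemma covering_map_free_action : covering_map p.
Proof.
split => // b.
have [e _ <-] : range p b by rewrite p_surj.
have [V oV [Ve Vfree]] := g_free e.
have pg i x : p (g i x) = p x by apply/p_fiber; exists i.
exists (p @` V); split; [exact: p_open|by exists e|].
pose W i := h i @^-1` V.
have oW i : open (W i) by apply: open_comp => // x _; exact: h_continuous.
have p_inj i x y : W i x -> W i y -> p x = p y -> x = y.
  rewrite /W /= => Wx Wy pxy.
  have /p_fiber[k hxy] : p (h i x) = p (h i y).
    by rewrite -(pg i) hK -[RHS](pg i) hK.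
  have k0 : i0 = k by apply: (Vfree _ _ (h i x) (h i y)) => //; rewrite g_id.
  by rewrite -(hK i x) hxy -k0 g_id hK.
exists I, W; split => //.
- move=> i j _ _ [x [/= Wix Wjx]].
  by apply: Vfree Wix Wjx _; rewrite !hK.
- rewrite eqEsubset; split=> x /=.
    move=> [y Vy /esym/p_fiber[i xE]]; exists i => //.
    by rewrite /W /= xE gK.
  by move=> [i _ Wx]; exists (h i x) => //; rewrite -(pg i) hK.
move=> i.
(* The section is made total by the dummy value [e] off the image of [V]. *)
have /choice[s sP] : forall b, exists x, (p @` V) b -> W i x /\ p x = b.
  move=> b'; have [[y Vy <-]|nVb] := pselect ((p @` V) b'); last by exists e.
  by exists (g i y) => _; rewrite /W /= gK pg.
have sK x : W i x -> s (p x) = x.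
  move=> Wx; have [|? ?] := sP (p x); last exact: (p_inj i).
  by exists (h i x) => //; rewrite -(pg i) hK.
exists s; split=> //.
(* On the image of the part of the sheet inside [O], open because [p] is open, the section takes
   values in [O]. *)
apply/within_continuousT => b' Vb' U; rewrite nbhsE => -[O [oO Os] OU].
have [Ws ps] := sP b' Vb'.
have nVW : nbhs b' (p @` (O `&` W i)).
  apply: open_nbhs_nbhs; split; last by exists (s b').
  by apply: p_open; exact: openI.
apply: (@filterS _ _ (nbhs_filter b') _ _ _ nVW).
by move=> _ [x [Ox Wx] <-] _; apply: OU; rewrite sK.
Qed.

End FreeAction.

Lemma disjoint_values_near (T U : topologicalType) (f g : T -> U) (x : T) :
  hausdorff_space U -> {for x, continuous f} -> {for x, continuous g} ->
  f x <> g x -> exists2 A, nbhs x A & forall y z, A y -> A z -> f y <> g z.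
Proof.
rewrite open_hausdorff => hU cf cg /eqP fg.
have [[P Q] /= [Pf Qg] [oP oQ PQ]] := hU _ _ fg.
exists (f @^-1` P `&` g @^-1` Q).
  apply: filterI; [apply: cf|apply: cg]; apply: open_nbhs_nbhs; split => //.
    by rewrite -in_setE.
  by rewrite -in_setE.
move=> y z [Py _] [_ Qz] fgyz.
have : (P `&` Q) (f y) by split => //; rewrite fgyz.
by move/eqP : PQ => ->.
Qed.

(** * The action of Z_7 x Z_7 on the orbit configuration space *)

Section LensCovering.
Variable R : realType.
Local Notation C := (R[i]^o).

Lemma rot7_S3 k (x : S3 R) : S3_set (rot7 k (\val x)).
Proof.
by apply/S3_setP; rewrite /= !normsqM normsq_zeta7X !mul1r; exact: S3_normsq.
Qed.

Definition rotS3 (k : nat) (x : S3 R) : S3 R := mkS3 (rot7_S3 k x).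

Lemma rotS3_continuous k : continuous (rotS3 k).
Proof.
move=> x; apply: continuous_at_set_type; apply: (continuous_at_comp (g := @rot7 R k)).
  exact: set_val_continuous.
exact: rot7_continuous.
Qed.

Lemma rotS3_modD m n x : (m + n)%N = 7%N -> rotS3 m (rotS3 n x) = x.
Proof.
by move=> mn; apply: val_inj; rewrite /= rot7D mn -rot7_mod modnn rot70.
Qed.

(** If two distinct rotations agree at [x], a nonzero difference of powers of zeta kills both
    coordinates, and 0 is not on the sphere. *)
Lemma rot7_free (i j : 'I_7) (x : S3 R) :
  rot7 i (\val x) = rot7 j (\val x) -> i = j.
Proof.
wlog ij : i j / (i <= j)%N.
  by move=> H; have [/H//|/ltnW/H] := leqP i j; move=> + /esym => /[apply].
move=> [/eqP E1 /eqP E2]; apply/val_inj/eqP; rewrite eqn_leq ij /=.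
apply: contraT => /=; rewrite -ltnNge => ltij.
have z1 : zeta7 R ^+ (j - i) != 1.
  apply: zeta7X_neq1; rewrite subn_gt0 ltij/=.
  by rewrite (leq_ltn_trans (leq_subr _ _)).
have zi0 : zeta7 R ^+ i != 0.
  by rewrite -normsq_eq0 normsq_zeta7X oner_eq0.
have kill (a : R[i]) : zeta7 R ^+ i * a == zeta7 R ^+ j * a -> a = 0.
  rewrite -(subnK (ltnW ltij)) exprD -subr_eq0 mulrAC [_ * a * _]mulrC -mulrBr.
  rewrite mulf_eq0 (negbTE zi0)/= -{1}[a]mul1r -mulrBl mulf_eq0 subr_eq0.
  by rewrite eq_sym (negbTE z1)/= => /eqP.
have := S3_normsq x; rewrite (kill _ E1) (kill _ E2).
by rewrite /normsq /= expr0n/= !addr0 => /eqP; rewrite eq_sym oner_eq0.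
Qed.

Lemma complex_pair_hausdorff : hausdorff_space (C * C)%type.
Proof. exact: norm_hausdorff. Qed.

(** Two distinct rotations have distinct values at [x], hence disjoint values near it; the
    neighbourhoods for the finitely many pairs are intersected. *)
Lemma rotS3_free_near (x : S3 R) : exists2 A, nbhs x A &
  forall (i j : 'I_7) y z, A y -> A z -> rotS3 i y = rotS3 j z -> i = j.
Proof.
have H (ij : 'I_7 * 'I_7) : exists A : set (S3 R), nbhs x A /\
    forall y z, A y -> A z -> rotS3 ij.1 y = rotS3 ij.2 z -> ij.1 = ij.2.
  have [ij12|/eqP ij12] := eqVneq ij.1 ij.2.
    by exists setT; split => //; exact: filterT.
  have [| | |A nA AP] := @disjoint_values_near (S3 R) _
    (rot7 ij.1 \o \val) (rot7 ij.2 \o \val) x complex_pair_hausdorff.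
  - by apply: continuous_comp; [exact: set_val_continuous|exact: rot7_continuous].
  - by apply: continuous_comp; [exact: set_val_continuous|exact: rot7_continuous].
  - by move=> /rot7_free.
  - exists A; split => // y z Ay Az /(congr1 \val) /= E.
    by have := AP _ _ Ay Az E.
have /choice[A AP] := H.
exists (\bigcap_(ij in [set: 'I_7 * 'I_7]) A ij).
  have nA : nbhs x [set y | forall ij, A ij y].
    by apply: (@filter_forall _ _ A (nbhs x)) => ij; have [] := AP ij.
  by apply: (@filterS _ _ (nbhs_filter x) _ _ _ nA) => y Ay ij _.
move=> i j y z Ay Az; have [_ H'] := AP (i, j).
by apply: H'; [exact: Ay|exact: Az].
Qed.

(** Openness in the quotient is tested on the saturation of [O], the union of its seven
    translates. *)
Lemma lens_proj_open (O : set (S3 R)) : open O -> open (@lens_proj R @` O).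
Proof.
move=> oO; rewrite /open /= /quotient_open.
have -> : \pi_{eq_quot lens_equiv R} @^-1` (@lens_proj R @` O) =
    \bigcup_(k in [set: 'I_7]) (rotS3 k @^-1` O).
  rewrite eqEsubset; split=> x /=.
    move=> [y Oy /lens_projP[k yE]]; exists k => //=.
    have -> : rotS3 k x = y by apply: val_inj; rewrite /= yE.
    by [].
  move=> [k _ Okx]; exists (rotS3 k x) => //.
  by apply/lens_projP; exists k.
by apply: bigcup_open => k _; apply: open_comp => // y _; exact: rotS3_continuous.
Qed.

Lemma lens_proj_continuous : continuous (@lens_proj R).
Proof. exact: pi_continuous. Qed.

Lemma lens_proj_surj (l : L71 R) : exists x, lens_proj x = l.
Proof. by exists (repr l); rewrite /lens_proj reprK. Qed.

Lemma orbit_F2_setP (p : S3 R * S3 R) :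
  orbit_F2_set p <-> lens_proj p.1 <> lens_proj p.2.
Proof.
split=> [pO /lens_projP[k]|pO k pE]; first exact: pO.
by apply: pO; apply/lens_projP; exists k.
Qed.

Lemma lens_proj_rot k x : lens_proj (rotS3 k x) = lens_proj x.
Proof.
apply/lens_projP; exists (Ordinal (ltn_pmod k (isT : 0 < 7)%N)).
by rewrite /= rot7_mod.
Qed.

Lemma rot_orbit_F2 (k l : nat) (p : orbit_F2 R) :
  orbit_F2_set (rotS3 k (\val p).1, rotS3 l (\val p).2).
Proof.
apply/orbit_F2_setP => /=; rewrite !lens_proj_rot.
by apply/orbit_F2_setP; exact/set_mem/valP.
Qed.

Definition rotF2 (k l : nat) (p : orbit_F2 R) : orbit_F2 R :=
  exist _ (rotS3 k (\val p).1, rotS3 l (\val p).2)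
    (mem_set (@rot_orbit_F2 k l p)).

Lemma rotF2_continuous k l : continuous (rotF2 k l).
Proof.
move=> p; apply: continuous_at_set_type; apply: continuous_at_pair.
  apply: (continuous_at_comp (g := rotS3 k)); last exact: rotS3_continuous.
  by complex_continuity.
apply: (continuous_at_comp (g := rotS3 l)); last exact: rotS3_continuous.
by complex_continuity.
Qed.

Lemma rotF2K k l m n : (k + m)%N = 7%N -> (l + n)%N = 7%N ->
  cancel (rotF2 m n) (rotF2 k l).
Proof.
move=> km ln p; apply: val_inj; rewrite /= !rotS3_modD//.
by case: (\val p).
Qed.

Lemma orbit_F2_proj_continuous : continuous (@orbit_F2_proj R).
Proof.
move=> p; apply: continuous_at_set_type; apply: continuous_at_pair.
  apply: (continuous_at_comp (g := @lens_proj R)); last exact: lens_proj_continuous.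
  by complex_continuity.
apply: (continuous_at_comp (g := @lens_proj R)); last exact: lens_proj_continuous.
by complex_continuity.
Qed.

(** A product neighbourhood has open images in both factors. A pair of distinct points in the
    product of these images lifts coordinatewise, and the lift is an orbit configuration because its
    projections differ. *)
Lemma orbit_F2_proj_open (O : set (orbit_F2 R)) :
  open O -> open (@orbit_F2_proj R @` O).
Proof.
move=> [W oW WO]; rewrite openE => _ [p Op <-].
have Wp : W (\val p) by move: Op; rewrite -WO.
have [[/= A B] [nA nB] AB] : nbhs (\val p) W by exact: open_nbhs_nbhs.
move: nA nB; rewrite !nbhsE => -[A' [oA' A'p] A'A] [B' [oB' B'p] B'B].
pose Q : set (L71 R * L71 R) := (@lens_proj R @` A') `*` (@lens_proj R @` B').
have nQ : nbhs (\val (orbit_F2_proj p)) Q.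
  have nA' : nbhs (lens_proj (\val p).1) (@lens_proj R @` A').
    by apply: open_nbhs_nbhs; split; [exact: lens_proj_open|exists (\val p).1].
  have nB' : nbhs (lens_proj (\val p).2) (@lens_proj R @` B').
    by apply: open_nbhs_nbhs; split; [exact: lens_proj_open|exists (\val p).2].
  by exists (@lens_proj R @` A', @lens_proj R @` B').
have nQ' := @set_val_continuous _ _ (orbit_F2_proj p) _ nQ.
apply: (@filterS _ _ (nbhs_filter _) _ _ _ nQ').
move=> q [/= [x A'x xq] [y B'y yq]].
have xyO : orbit_F2_set (x, y).
  apply/orbit_F2_setP => /=; rewrite xq yq.
  by have := set_mem (valP q).
exists (exist _ (x, y) (mem_set xyO)); last first.
  by apply: val_inj; rewrite /= xq yq; case: (\val q).
by rewrite -WO; apply: AB; split => /=; [exact: A'A|exact: B'B].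
Qed.

Lemma orbit_F2_proj_covering : covering_map (@orbit_F2_proj R).
Proof.
(* The inverse rotation is by [7 - k], which is 7 and not 0 when [k = 0]. *)
apply: (@covering_map_free_action _ _ _ ('I_7 * 'I_7)%type
  (fun ij => rotF2 ij.1 ij.2) (fun ij => rotF2 (7 - ij.1) (7 - ij.2))
  (ord0, ord0)).
- exact: orbit_F2_proj_continuous.
- rewrite -subTset => q _.
  have [x xq] := lens_proj_surj (\val q).1.
  have [y yq] := lens_proj_surj (\val q).2.
  have xyO : orbit_F2_set (x, y).
    apply/orbit_F2_setP => /=; rewrite xq yq.
    by have := set_mem (valP q).
  exists (exist _ (x, y) (mem_set xyO)) => //.
  by apply: val_inj; rewrite /= xq yq -surjective_pairing.
- exact: orbit_F2_proj_open.
- by move=> ij; exact: rotF2_continuous.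
- by move=> ij; apply: rotF2K; rewrite subnKC// ltnW.
- by move=> ij; apply: rotF2K; rewrite subnK// ltnW.
- move=> p; apply: val_inj => /=; rewrite [RHS]surjective_pairing.
  by congr (_, _); apply: val_inj; rewrite /= rot70.
- move=> p q; split=> [|[ij ->]]; last first.
    by apply: val_inj; rewrite /= !lens_proj_rot.
  move=> /(congr1 \val) [/lens_projP[i pi] /lens_projP[j pj]]; exists (i, j).
  apply: val_inj => /=; rewrite [LHS]surjective_pairing.
  by congr (_, _); apply: val_inj.
- move=> p; have [A nA AP] := rotS3_free_near (\val p).1.
  have [B nB BP] := rotS3_free_near (\val p).2.
  move: nA nB; rewrite !nbhsE => -[A' [oA' A'p] A'A] [B' [oB' B'p] B'B].
  exists (\val @^-1` (A' `*` B')).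
    apply: open_comp; first by move=> ? _; exact: set_val_continuous.
    apply: (@openI _ (fst @^-1` A') (snd @^-1` B')); apply: open_comp => // ? _.
      exact: cvg_fst.
    exact: cvg_snd.
  split => // -[i i'] [j j'] x y [/= /A'A Ax /B'B Bx] [/= /A'A Ay /B'B By].
  move=> E.
  have -> : i = j by apply: (AP _ _ _ _ Ax Ay); exact: (congr1 (fun q => (\val q).1) E).
  have -> // : i' = j'.
  by apply: (BP _ _ _ _ Bx By); exact: (congr1 (fun q => (\val q).2) E).
Qed.

End LensCovering.

(** * Splitting off a quaternion factor *)

(** Turns a formula that lands in [A] only near [x] into a map to the subspace; the default [a] is
    not taken near [x]. *)
Lemma insubd_continuous (T U : topologicalType) (A : set U) (a : set_type A)
    (f : T -> U) (x : T) :
  continuous_at x f -> (\forall t \near x, A (f t)) ->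
  @continuous_at T (set_type A) x (fun t => insubd a (f t)).
Proof.
move=> cf Af; apply: continuous_at_set_type => V.
rewrite val_insubd mem_set; last exact: nbhs_singleton Af.
move=> /cf fV.
apply: (@filterS2 _ _ (nbhs_filter x) _ _ _ _ fV Af) => t Vt At.
by rewrite /preimage/= val_insubd mem_set.
Qed.

Section Quaternions.
Variable R : realType.
Local Notation C := (R[i]^o).

(** Quaternion multiplication, the pair [x] standing for x_1 + x_2 j with j z = z^* j. *)
Definition qmul (x y : C * C) : C * C :=
  (x.1 * y.1 - x.2 * y.2^*, x.1 * y.2 + x.2 * y.1^*).

(** The product of [x] with the quaternion conjugate of [y], which is x y^-1 for a unit [y]. *)
Definition qdiv (x y : C * C) : C * C :=
  (x.1 * y.1^* + x.2 * y.2^*, x.2 * y.1 - x.1 * y.2).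

Definition qnorm (x : C * C) : R := normsq x.1 + normsq x.2.

Lemma qnorm_mul x y : qnorm (qmul x y) = qnorm x * qnorm y.
Proof. by rewrite /qnorm /normsq /qmul/= !ReImE; ring. Qed.

Lemma qnorm_div x y : qnorm (qdiv x y) = qnorm x * qnorm y.
Proof. by rewrite /qnorm /normsq /qdiv/= !ReImE; ring. Qed.

Lemma qdivK x y : qnorm y = 1 -> qmul (qdiv x y) y = x.
Proof.
move=> y1; rewrite [RHS]surjective_pairing; congr (_, _); apply: complex_ext.
- rewrite -[RHS]mulr1 -y1 /qnorm /normsq /= !ReImE; ring.
- rewrite -[RHS]mulr1 -y1 /qnorm /normsq /= !ReImE; ring.
- rewrite -[RHS]mulr1 -y1 /qnorm /normsq /= !ReImE; ring.
- rewrite -[RHS]mulr1 -y1 /qnorm /normsq /= !ReImE; ring.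
Qed.

Lemma qmulK x y : qnorm y = 1 -> qdiv (qmul x y) y = x.
Proof.
move=> y1; rewrite [RHS]surjective_pairing; congr (_, _); apply: complex_ext.
- rewrite -[RHS]mulr1 -y1 /qnorm /normsq /= !ReImE; ring.
- rewrite -[RHS]mulr1 -y1 /qnorm /normsq /= !ReImE; ring.
- rewrite -[RHS]mulr1 -y1 /qnorm /normsq /= !ReImE; ring.
- rewrite -[RHS]mulr1 -y1 /qnorm /normsq /= !ReImE; ring.
Qed.

(** Links the diagonal action of Z_7 to left multiplication by the punctures. *)
Lemma qmul_scalar c y : qmul (c, 0) y = (c * y.1, c * y.2).
Proof. by rewrite /qmul/= !mul0r subr0 addr0. Qed.

Lemma qmul_continuous : continuous (fun p : (C * C) * (C * C) => qmul p.1 p.2).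
Proof. by move=> p; rewrite /qmul; complex_continuity. Qed.

Lemma qdiv_continuous : continuous (fun p : (C * C) * (C * C) => qdiv p.1 p.2).
Proof. by move=> p; rewrite /qdiv; complex_continuity. Qed.

Lemma qnorm_continuous : continuous qnorm.
Proof. by move=> p; rewrite /qnorm; complex_continuity. Qed.

Lemma qnorm_ge0 x : 0 <= qnorm x.
Proof. by rewrite addr_ge0 ?normsq_ge0. Qed.

Lemma qnorm_eq0 x : (qnorm x == 0) = (x == 0).
Proof. by rewrite paddr_eq0 ?normsq_ge0// !normsq_eq0. Qed.

Definition unitize (x : C * C) : C * C :=
  (((Num.sqrt (qnorm x))^-1)%:C * x.1, ((Num.sqrt (qnorm x))^-1)%:C * x.2).

Lemma normsq_real (r : R) : normsq r%:C = r ^+ 2.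
Proof. by rewrite /normsq/= expr0n addr0. Qed.

Lemma unitize_S3 x : x != 0 -> S3_set (unitize x).
Proof.
rewrite -qnorm_eq0 => x0; apply/S3_setP; rewrite /= !normsqM normsq_real.
by rewrite -mulrDr exprVn sqr_sqrtr ?qnorm_ge0// mulVf.
Qed.

Lemma unitize_id x : S3_set x -> unitize x = x.
Proof.
move=> /S3_setP x1; rewrite /unitize /qnorm x1 sqrtr1 invr1 !mul1r.
by rewrite -surjective_pairing.
Qed.

Lemma unitize_continuous (x : C * C) : x != 0 -> continuous_at x unitize.
Proof.
move=> x0; rewrite /unitize; complex_continuity.
- by rewrite sqrtr_eq0 -ltNge lt_neqAle qnorm_ge0 andbT eq_sym qnorm_eq0.
- exact: qnorm_continuous.
- by rewrite sqrtr_eq0 -ltNge lt_neqAle qnorm_ge0 andbT eq_sym qnorm_eq0.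
- exact: qnorm_continuous.
Qed.

Lemma S3_setE x : S3_set x <-> qnorm x = 1.
Proof. exact: S3_setP. Qed.

Lemma qnorm_S3 (x : S3 R) : qnorm (\val x) = 1.
Proof. exact: S3_normsq. Qed.

End Quaternions.

(** * The punctured sphere and the rays through its punctures *)

Section PuncturedSphere.
Variable R : realType.
Local Notation C := (R[i]^o).

Definition punctured_set : set (C * C) :=
  [set x | S3_set x /\ forall k : 'I_7, x <> (zeta7 R ^+ k, 0)].

Definition punctured_S3 : topologicalType := set_type punctured_set.

Lemma punctured_qnorm (x : punctured_S3) : qnorm (\val x) = 1.
Proof. by have [/S3_setE] := set_mem (valP x). Qed.

Lemma punctured_of_orbit (p : orbit_F2 R) :
  punctured_set (qdiv (\val (\val p).1) (\val (\val p).2)).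
Proof.
split; first by apply/S3_setE; rewrite qnorm_div !qnorm_S3 mulr1.
move=> k E; have := set_mem (valP p) k; apply.
rewrite -[LHS](qdivK _ (qnorm_S3 (\val p).2)) E qmul_scalar.
by [].
Qed.

Lemma qmul_punctured_S3 (q : punctured_S3 * S3 R) :
  S3_set (qmul (\val q.1) (\val q.2)).
Proof. by apply/S3_setE; rewrite qnorm_mul punctured_qnorm qnorm_S3 mulr1. Qed.

Lemma orbit_of_punctured (q : punctured_S3 * S3 R) :
  orbit_F2_set (mkS3 (qmul_punctured_S3 q), q.2).
Proof.
move=> k /= E; have [_ /(_ k)] := set_mem (valP q.1); apply.
rewrite -[LHS](qmulK _ (qnorm_S3 q.2)) E.
have -> : rot7 k (\val q.2) = qmul (zeta7 R ^+ k, 0) (\val q.2).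
  by rewrite qmul_scalar.
by rewrite qmulK// qnorm_S3.
Qed.

Definition orbit_split (p : orbit_F2 R) : punctured_S3 * S3 R :=
  (exist _ (qdiv (\val (\val p).1) (\val (\val p).2))
     (mem_set (punctured_of_orbit p)), (\val p).2).

Definition orbit_join (q : punctured_S3 * S3 R) : orbit_F2 R :=
  exist _ (mkS3 (qmul_punctured_S3 q), q.2) (mem_set (@orbit_of_punctured q)).

Lemma orbit_splitK : cancel orbit_split orbit_join.
Proof.
move=> p; apply: val_inj; rewrite /= [RHS]surjective_pairing; congr (_, _).
by apply: val_inj; rewrite /= qdivK// qnorm_S3.
Qed.

Lemma orbit_joinK : cancel orbit_join orbit_split.
Proof.
move=> q; rewrite [RHS]surjective_pairing; congr (_, _).
by apply: val_inj; rewrite /= qmulK// qnorm_S3.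
Qed.

Lemma orbit_split_continuous : continuous orbit_split.
Proof.
move=> p; apply: continuous_at_pair; last by complex_continuity.
apply: continuous_at_set_type; rewrite /=.
apply: (continuous_at_comp (f := fun p : orbit_F2 R =>
  (\val (\val p).1, \val (\val p).2)) (g := fun p => qdiv p.1 p.2));
  last exact: qdiv_continuous.
by complex_continuity.
Qed.

Lemma orbit_join_continuous : continuous orbit_join.
Proof.
move=> q; apply: continuous_at_set_type; apply: continuous_at_pair;
  last by complex_continuity.
apply: continuous_at_set_type; rewrite /=.
apply: (continuous_at_comp (f := fun q : punctured_S3 * S3 R =>
  (\val q.1, \val q.2)) (g := fun p => qmul p.1 p.2));
  last exact: qmul_continuous.
by complex_continuity.
Qed.

(** The squared distance to the closed ray from 0 through the [k]-th puncture: after rotating the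
    ray onto the nonnegative reals, the real part counts only when negative. *)
Definition ray_dist (k : nat) (x : C * C) : R :=
  Im (x.1 * (zeta7 R ^+ k)^*) ^+ 2 + normsq x.2 +
  Num.min 0 (Re (x.1 * (zeta7 R ^+ k)^*)) ^+ 2.

Lemma ray_dist_continuous k : continuous (ray_dist k).
Proof. by move=> x; rewrite /ray_dist; complex_continuity. Qed.

Lemma ray_dist_eq0 k x : ray_dist k x = 0 ->
  exists2 t : R, 0 <= t & x = (t%:C * zeta7 R ^+ k, 0).
Proof.
move=> /eqP; rewrite paddr_eq0 ?addr_ge0 ?sqr_ge0 ?normsq_ge0//.
rewrite paddr_eq0 ?sqr_ge0 ?normsq_ge0// !sqrf_eq0 normsq_eq0.
move=> /andP[/andP[/eqP i0 /eqP x20] /eqP r0].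
exists (Re (x.1 * (zeta7 R ^+ k)^*)).
  by rewrite -r0 ge_min lexx orbT.
rewrite [LHS]surjective_pairing x20; congr (_, _).
have -> : (Re (x.1 * (zeta7 R ^+ k)^*))%:C = x.1 * (zeta7 R ^+ k)^*.
  by apply: complex_ext.
rewrite -mulrA [X in _ = _ * X](_ : _ = 1) ?mulr1//.
apply: complex_ext; rewrite !ReImE /=.
  by rewrite -(normsq_zeta7X R k) /normsq; ring.
by ring.
Qed.

Lemma ray_dist_ray k (t : R) : 0 <= t -> ray_dist k (t%:C * zeta7 R ^+ k, 0) = 0.
Proof.
move=> t0; rewrite /ray_dist /= !ReImE /= min_l.
  by rewrite /normsq/=; ring.
have -> : (t * Re (zeta7 R ^+ k) - 0 * Im (zeta7 R ^+ k)) * Re (zeta7 R ^+ k) -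
    (t * Im (zeta7 R ^+ k) + 0 * Re (zeta7 R ^+ k)) * - Im (zeta7 R ^+ k) =
    t * normsq (zeta7 R ^+ k) by rewrite /normsq; ring.
by rewrite normsq_zeta7X mulr1.
Qed.

(** The open cone over the punctured sphere, on which radial projection to it is defined; it
    excludes 0, which lies on every ray. *)
Definition off_rays (x : C * C) : Prop := forall k : 'I_7, ray_dist k x <> 0.

Lemma off_rays_neq0 x : off_rays x -> x != 0.
Proof.
move=> xr; apply/eqP => x0; apply: (xr ord0).
by rewrite x0 -[X in ray_dist _ X](_ : (0%:C * zeta7 R ^+ 0, 0) = _)
  ?ray_dist_ray// mul0r.
Qed.

Lemma unitize_punctured x : off_rays x -> punctured_set (unitize x).
Proof.
move=> xr; have x0 := off_rays_neq0 xr; split; first exact: unitize_S3.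
have s0 : 0 < Num.sqrt (qnorm x).
  by rewrite sqrtr_gt0 lt_neqAle qnorm_ge0 andbT eq_sym qnorm_eq0.
move=> k [E1 E2]; apply: (xr k).
have -> : x = ((Num.sqrt (qnorm x))%:C * zeta7 R ^+ k, 0).
  rewrite [LHS]surjective_pairing; congr (_, _).
    by rewrite -E1 mulrA -rmorphM divff ?gt_eqF// mul1r.
  move/eqP : E2; rewrite mulf_eq0 => /orP[|/eqP//].
  by rewrite -normsq_eq0 normsq_real sqrf_eq0 invr_eq0 gt_eqF.
by apply: ray_dist_ray; exact: ltW.
Qed.

Lemma punctured_off_rays x : punctured_set x -> off_rays x.
Proof.
move=> [/S3_setE x1 xk] k /ray_dist_eq0[t t0 xE]; apply: (xk k).
have : t ^+ 2 = 1.
  rewrite -x1 xE /qnorm /= normsqM normsq_real normsq_zeta7X.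
  by rewrite /normsq /= expr0n/= !addr0 mulr1.
move=> /eqP; rewrite sqrp_eq1// => /eqP t1.
by rewrite xE t1 mul1r.
Qed.

Lemma near_off_rays (x : C * C) : off_rays x -> \forall y \near x, off_rays y.
Proof.
move=> xr.
apply: (@filter_forall _ _ (fun (k : 'I_7) (y : C * C) => ray_dist k y <> 0)
  (nbhs x)) => k.
have /ray_dist_continuous : nbhs (ray_dist k x) [set r : R | r != 0].
  by apply: open_nbhs_nbhs; split; [exact: open_neq|exact/eqP/xr].
by apply: (@filterS _ _ (nbhs_filter x)) => y /= /eqP.
Qed.

End PuncturedSphere.

(** * Caps on the circle *)

Section Caps.
Variable R : realType.

(** The 14th roots of unity: even indices give the punctures, odd ones the midpoints of the arcs. *)
Definition circ (n : nat) : R[i] := cos (pi / 7 *+ n) +i* sin (pi / 7 *+ n).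

Definition arc_mid (k : nat) : R[i] := circ k.*2.+1.

(** An affine function, positive on the cap of m_k. The constant is the cosine of the angle from m_k
    to either adjacent puncture, so it vanishes at both. *)
Definition cap (k : nat) (a : R[i]) : R := Re (a * (arc_mid k)^*) - cos (pi / 7).

Lemma normsq_circ n : normsq (circ n) = 1.
Proof. exact: cos2Dsin2. Qed.

Lemma zeta7X_circ k : zeta7 R ^+ k = circ k.*2.
Proof.
rewrite zeta7X /circ; suff -> : 2 * pi / 7 *+ k = pi / 7 *+ k.*2 :> R by [].
by rewrite -muln2 mulrnA -[pi / 7 *+ k *+ 2]mulr_natl mulrnAr mulrA.
Qed.

Lemma Re_circ_conj m n : (m <= n)%N ->
  Re (circ n * (circ m)^*) = cos (pi / 7 *+ (n - m)).
Proof.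
by move=> mn; rewrite mulrnBr// cosB !ReImE /=; ring.
Qed.

Lemma Re_circ_conjC m n : Re (circ n * (circ m)^*) = Re (circ m * (circ n)^*).
Proof. by rewrite !ReImE; ring. Qed.

(** The cosine decreases on [0, pi] and is invariant under [n] to [14 - n]; the hypothesis says that
    [n] is cyclically at least as far from 0 as [m]. *)
Lemma cos_seventh_le m n : (m <= n <= 14 - m)%N ->
  cos (pi / 7 *+ n) <= cos (pi / 7 *+ m) :> R.
Proof.
have p0 := pi_gt0 R.
have base k l : (k <= l <= 7)%N -> cos (pi / 7 *+ l) <= cos (pi / 7 *+ k) :> R.
  move=> /andP[kl l7]; rewrite leNgt; apply/negP.
  have I0 j : (j <= 7)%N -> pi / 7 *+ j \in `[0, (pi : R)].
    move=> j7; rewrite in_itv/= -[_ *+ j]mulr_natr mulr_ge0 ?divr_ge0 ?(ltW p0)//=.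
    by rewrite [pi / 7 * _]mulrAC ler_pdivrMr// ler_pM2l// ler_nat.
  rewrite ltr_cos ?I0// ?(leq_trans kl)// ltNge => /negP; apply.
  by rewrite ler_pMn2l// divr_gt0.
move=> /andP[mn n14]; have [n7|n7] := leqP n 7; first by rewrite base ?mn.
have -> : cos (pi / 7 *+ n) = cos (pi / 7 *+ (14 - n)) :> R.
  rewrite mulrnBr; last by rewrite (leq_trans n14)// leq_subr.
  have -> : pi / 7 *+ 14 = pi *+ 2 :> R.
    by rewrite -[_ *+ 14]mulr_natr -[_ *+ 2]mulr_natr; field.
  by rewrite addrC cosD2pi cosN.
by apply: base; lia.
Qed.

Lemma cos_pi7_gt0 : 0 < cos (pi / 7) :> R.
Proof.
have p0 := pi_gt0 R.
apply: cos_gt0_pihalf; apply/andP; split.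
  by rewrite (@lt_trans _ _ 0)// ?oppr_lt0 divr_gt0.
by rewrite ltr_pM2l// ltf_pV2 ?posrE// ltr_nat.
Qed.

(** An even and an odd index differ by at least one step modulo 14. *)
Lemma cap_zeta k j : (k < 7)%N -> (j < 7)%N -> cap k (zeta7 R ^+ j) <= 0.
Proof.
move=> k7 j7; rewrite /cap zeta7X_circ subr_le0 -[leRHS](congr1 cos (mulr1n _)).
have [jk|jk] := leqP k.*2.+1 j.*2.
  by rewrite Re_circ_conj//; apply: cos_seventh_le; lia.
by rewrite Re_circ_conjC Re_circ_conj; [apply: cos_seventh_le; lia|lia].
Qed.

Lemma cap_mid k : 0 < cap k (arc_mid k).
Proof.
rewrite /cap Re_circ_conj// subnn mulr0n cos0 subr_gt0.
rewrite lt_neqAle cos_le1 andbT; apply/eqP => c1.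
have p0 := pi_gt0 R.
have : 0 < sin (pi / 7) :> R.
  by apply: sin_gt0_pi; rewrite divr_gt0//= gtr_pMr// invf_lt1// ltr1n.
by rewrite lt_neqAle (cos1sin0 (_ : `|cos _| = 1)) ?eqxx// c1 normr1.
Qed.

Lemma Re_mul_conj_le (a b : R[i]) : Re (a * b^*) ^+ 2 <= normsq a * normsq b.
Proof.
have -> : normsq a * normsq b = Re (a * b^*) ^+ 2 + Im (a * b^*) ^+ 2.
  by rewrite /normsq !ReImE; ring.
by rewrite lerDl sqr_ge0.
Qed.

(* If both hold then [Re (a * (m_i + m_j)^* )] exceeds [2 cos (pi / 7)], which bounds
   [`|m_i + m_j|]: this contradicts Cauchy-Schwarz. *)
Lemma cap_disjoint i j a : (i < 7)%N -> (j < 7)%N -> normsq a <= 1 ->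
  0 <= cap i a -> 0 < cap j a -> i = j.
Proof.
move=> i7 j7 a1; rewrite /cap => ia ja; apply/eqP; apply: contraT => ij.
have c0 := cos_pi7_gt0.
(* Distinct odd indices are at least two steps apart modulo 14. *)
have dot : Re (arc_mid i * (arc_mid j)^*) <= cos (pi / 7 *+ 2).
  have [lij|lij] := leqP i.*2.+1 j.*2.+1.
    rewrite Re_circ_conjC Re_circ_conj//; apply: cos_seventh_le.
    by move/eqP : ij; lia.
  rewrite Re_circ_conj; last by lia.
  by apply: cos_seventh_le; move/eqP : ij; lia.
(* This turns the bound [2 + 2 cos (2 pi / 7)] on the squared length of m_i + m_j into
   [4 cos (pi / 7) ^ 2]. *)
rewrite cos_mulr2n in dot.
have nm : normsq (arc_mid i + arc_mid j) <= 4 * cos (pi / 7) ^+ 2.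
  have -> : normsq (arc_mid i + arc_mid j) = normsq (arc_mid i) +
      normsq (arc_mid j) + 2 * Re (arc_mid i * (arc_mid j)^*).
    by rewrite /normsq !ReImE; ring.
  by rewrite !normsq_circ; move: dot; lra.
have := Re_mul_conj_le a (arc_mid i + arc_mid j).
have -> : Re (a * (arc_mid i + arc_mid j)^*) =
    Re (a * (arc_mid i)^*) + Re (a * (arc_mid j)^*) by rewrite !ReImE; ring.
have := normsq_ge0 a; have := normsq_ge0 (arc_mid i + arc_mid j).
move: ia ja nm a1.
set u := Re _; set v := Re _; set N := normsq (_ + _); set M := normsq a.
set c := cos _ in c0 *; move=> u0 v0 Nc M1 N0 M0 uv.
have : M * N <= 4 * c ^+ 2 by nra.
have : 4 * c ^+ 2 < (u + v) ^+ 2 by nra.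
by lra.
Qed.

(** The arccosine of the real part on the upper half circle, and its reflection on the lower one. *)
Lemma unit_angle (a : R[i]) : normsq a = 1 ->
  exists2 phi : R, 0 <= phi < pi *+ 2 & a = cos phi +i* sin phi.
Proof.
case: a => x y; rewrite /normsq /= => xy1.
have p0 := pi_gt0 R.
have x1 : -1 <= x <= 1 by apply/andP; nra.
have acosx := acosK x1; have sacos := sin_acos x1.
have sy : Num.sqrt (1 - x ^+ 2) = `|y|.
  by rewrite -sqrtr_sqr -xy1 addrAC subrr add0r.
have a0 := acos_ge0 x1; have api := acos_lepi x1.
have [y0|y0] := leP 0 y.
  exists (acos x).
    by rewrite a0 (le_lt_trans api)// mulr2n ltrDl.
  by rewrite acosx sacos sy ger0_norm.
exists (pi *+ 2 - acos x).
  rewrite subr_ge0 (le_trans api) ?mulr2n ?lerDl ?ltW//= ltrBlDr ltrDl.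
  apply: acos_gt0; apply/andP; split; first by case/andP: x1.
  by nra.
have -> : pi *+ 2 - acos x = - acos x + pi *+ 2 by rewrite addrC.
rewrite cosD2pi sinD2pi cosN sinN acosx sacos sy ltr0_norm//.
by rewrite opprK.
Qed.

(** Truncating the angle in units of 2 pi / 7 finds the arc. Its left end is a puncture; any other
    point of it is at an angle less than pi / 7 from the midpoint. *)
Lemma cap_cover a : normsq a = 1 -> (forall k : 'I_7, a <> zeta7 R ^+ k) ->
  exists2 k : nat, (k < 7)%N & 0 < cap k a.
Proof.
move=> /unit_angle[phi /andP[phi0 phi2]] -> az.
have p0 := pi_gt0 R.
have t0 : 0 < pi / 7 *+ 2 :> R by rewrite pmulrn_lgt0// divr_gt0.
have q0 : 0 <= phi / (pi / 7 *+ 2) by rewrite divr_ge0// ltW.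
have /andP[kq qk] := truncn_itv q0; set k := Num.truncn _ in kq qk.
have E n : pi / 7 *+ n.*2 = n%:R * (pi / 7 *+ 2) :> R.
  by rewrite -muln2 mulnC mulrnA mulr_natl.
have k7 : (k < 7)%N.
  rewrite -(ltr_nat R) (le_lt_trans kq)// ltr_pdivrMr//.
  suff -> : 7%:R * (pi / 7 *+ 2) = pi *+ 2 :> R by [].
  by rewrite -[pi / 7 *+ 2]mulr_natr -[pi *+ 2]mulr_natr; field.
rewrite ler_pdivlMr// -E in kq; rewrite ltr_pdivrMr// -E in qk.
exists k => //; move: kq; rewrite le_eqVlt => /predU1P[kE|kq].
  by case: (az (Ordinal k7)); rewrite zeta7X_circ /circ /= kE.
rewrite /cap subr_gt0.
have -> : Re ((cos phi +i* sin phi) * (arc_mid k)^*) =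
    cos (phi - pi / 7 *+ k.*2.+1).
  by rewrite cosB !ReImE /=; ring.
set d := phi - _.
have dlt : `|d| < pi / 7.
  rewrite ltr_norml /d; move: kq qk; rewrite doubleS !mulrSr => kq qk.
  by apply/andP; split; lra.
rewrite -(cos_norm d) ltr_cos// in_itv/= ?normr_ge0/=.
  by rewrite (le_trans (ltW dlt))// ler_piMr ?ltW// invf_lt1// ltr1n.
by rewrite divr_ge0 ?(ltW p0)//= ltW// gtr_pMr// invf_lt1// ltr1n.
Qed.

Lemma arc_mid_neq_zeta k (j : 'I_7) : (k < 7)%N -> arc_mid k <> zeta7 R ^+ j.
Proof.
by move=> k7 E; have := cap_mid k; rewrite E ltNge cap_zeta.
Qed.

Lemma cap_mid_le0 i j : (i < 7)%N -> (j < 7)%N -> i <> j -> cap i (arc_mid j) <= 0.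
Proof.
move=> i7 j7 ij; rewrite leNgt; apply/negP => c0; apply: ij.
apply/esym; apply: (@cap_disjoint _ _ (arc_mid j)) => //.
  by rewrite normsq_circ.
by rewrite ltW// cap_mid.
Qed.

Lemma cap_convex k (s : R) a b :
  cap k (s%:C * a + (1 - s)%:C * b) = s * cap k a + (1 - s) * cap k b.
Proof. by rewrite /cap !ReImE /=; ring. Qed.

(** From 0 to a puncture the affine function [cap] goes from [- cos (pi / 7)] to a nonpositive
    value. *)
Lemma cap_ray_le0 k (j : 'I_7) (t : R) : (k < 7)%N -> 0 <= t <= 1 ->
  cap k (t%:C * zeta7 R ^+ j) <= 0.
Proof.
move=> k7 /andP[t0 t1]; have := @cap_zeta k j k7 (ltn_ord j).
have -> : cap k (t%:C * zeta7 R ^+ j) =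
    t * cap k (zeta7 R ^+ j) - (1 - t) * cos (pi / 7).
  by rewrite /cap !ReImE /=; ring.
have := cos_pi7_gt0; nra.
Qed.

End Caps.

(** * Simple connectivity of the orbit configuration space *)

Section SimpleConnectivity.
Variable R : realType.
Local Notation C := (R[i]^o).

Definition row4 (x : C * C) : 'rV[R]_4 :=
  \row_j [:: Re x.1; Im x.1; Re x.2; Im x.2]`_j.

Definition pair4 (v : 'rV[R]_4) : C * C :=
  (v 0 0 +i* v 0 1, v 0 (@Ordinal 4 2 isT) +i* v 0 (@Ordinal 4 3 isT)).

Lemma row4K : cancel row4 pair4.
Proof.
by move=> [[a b] [c d]]; rewrite /pair4 !mxE.
Qed.

Lemma pair4K : cancel pair4 row4.
Proof.
move=> v; apply/rowP => j; rewrite mxE /=.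
case: j => [[|[|[|[|//]]]] jlt] /=; congr (v _ _); exact: val_inj.
Qed.

Lemma row4_continuous : continuous row4.
Proof.
move=> x; apply: continuous_at_row => j.
have -> : (fun t => row4 t 0 j) =
    fun t => [:: Re t.1; Im t.1; Re t.2; Im t.2]`_j.
  by apply/funext => t; rewrite mxE.
by case: j => [[|[|[|[|//]]]] jlt] /=; complex_continuity.
Qed.

Lemma pair4_continuous : continuous pair4.
Proof.
move=> v; apply: continuous_at_pair; apply: continuous_at_complex => /=;
  by apply: continuous_at_coord; exact: cvg_id.
Qed.

Lemma pair4_scale (t : R) v :
  pair4 (t *: v) = (t%:C * (pair4 v).1, t%:C * (pair4 v).2).
Proof.
by congr (_, _); apply: complex_ext; rewrite !ReImE /= !mxE; ring.
Qed.

Lemma pair4_eq0 v : (pair4 v == 0) = (v == 0).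
Proof.
have p0 : pair4 0 = 0 by congr (_, _); apply: complex_ext; rewrite /= mxE.
by rewrite -[0 in LHS]p0 (can_eq pair4K).
Qed.

Definition S3_one : S3 R.
Proof.
apply: (@mkS3 R (1, 0)); apply/S3_setP.
by rewrite /normsq/= expr1n expr0n/= !addr0.
Defined.

(** The origin is treated as a degenerate line, spanned by the zero vector. *)
Lemma simply_connected_S3 : simply_connected R (S3 R).
Proof.
have closed0 : closed [set 0 : 'rV[R]_4].
  exact/accessible_closed_set1/hausdorff_accessible/norm_hausdorff.
apply: (@simply_connected_off_lines R 0 [set 0] [:: 0] _ _ (S3 R)
  (fun x => row4 (\val x)) (fun v => insubd S3_one (unitize (pair4 v))) S3_one).
- exact: closed0.
- by move=> v -> ; exists 0; rewrite ?mem_head//; exists 0; rewrite scaler0.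
- move=> x; apply: continuous_at_comp; first exact: set_val_continuous.
  exact: row4_continuous.
- move=> v /= /eqP v0; apply: insubd_continuous.
    apply: continuous_at_comp; first exact: pair4_continuous.
    by apply: unitize_continuous; rewrite pair4_eq0.
  have nv : nbhs v (~` [set 0]).
    by apply: open_nbhs_nbhs; split; [exact: closed_openC|exact/eqP].
  apply: (@filterS _ _ (nbhs_filter v) _ _ _ nv) => w /= /eqP w0.
  by apply: unitize_S3; rewrite pair4_eq0.
- move=> x /=; apply: val_inj; rewrite row4K val_insubd unitize_id.
    by rewrite (valP x).
  exact: set_mem (valP x).
- move=> x /= /(congr1 pair4); rewrite row4K => /eqP.
  rewrite [X in _ == X](_ : _ = 0); last by apply/eqP; rewrite pair4_eq0.
  by rewrite -qnorm_eq0 qnorm_S3 oner_eq0.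
Qed.

Lemma arc_mid_punctured k : (k < 7)%N ->
  punctured_set (arc_mid R k : C, 0 : C).
Proof.
move=> k7; split; last by move=> j [] /(arc_mid_neq_zeta k7).
by apply/S3_setP; rewrite /= normsq_circ /normsq/= expr0n/= !addr0.
Qed.

Definition punctured_base : punctured_S3 R :=
  exist _ (arc_mid R 6, 0) (mem_set (arc_mid_punctured (isT : 6 < 7)%N)).

(** Radial projection retracts the complement of the seven closed rays; the rays lie on the lines
    spanned by the punctures. *)
Lemma simply_connected_punctured : simply_connected R (punctured_S3 R).
Proof.
pose K := [set v : 'rV[R]_4 | exists k : 'I_7, ray_dist k (pair4 v) = 0].
have KP v : ~ K v <-> off_rays (pair4 v).
  by split=> [vK k d0|vr [k]]; [apply: vK; exists k|exact: vr].
have off_near v : off_rays (pair4 v) -> \forall w \near v, off_rays (pair4 w).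
  by move=> /near_off_rays/pair4_continuous.
apply: (@simply_connected_off_lines R 0 K
  [seq row4 (zeta7 R ^+ k : C, 0 : C) | k <- iota 0 7] _ _ (punctured_S3 R)
  (fun x => row4 (\val x)) (fun v => insubd punctured_base (unitize (pair4 v)))
  punctured_base).
- rewrite -openC openE => v /KP/off_near; apply: (@filterS _ _ (nbhs_filter v)).
  by move=> w /KP.
- move=> v [k /ray_dist_eq0[t t0 vE]].
  exists (row4 (zeta7 R ^+ k, 0)).
    by apply/mapP; exists (k : nat) => //; rewrite mem_iota /= add0n.
  exists t; apply: (can_inj pair4K); rewrite vE pair4_scale row4K /=.
  by rewrite mulr0.
- move=> x; apply: continuous_at_comp; first exact: set_val_continuous.
  exact: row4_continuous.
- move=> v /KP vr; apply: insubd_continuous.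
    apply: continuous_at_comp; first exact: pair4_continuous.
    by apply: unitize_continuous; exact: off_rays_neq0.
  apply: (@filterS _ _ (nbhs_filter v) _ _ _ (off_near v vr)) => w /=.
  exact: unitize_punctured.
- move=> x /=; apply: val_inj; rewrite row4K val_insubd unitize_id.
    by rewrite (valP x).
  by have [] := set_mem (valP x).
- move=> x; apply/KP; rewrite /= row4K; apply: punctured_off_rays.
  exact: set_mem (valP x).
Qed.

Lemma simply_connected_orbit_F2 : simply_connected R (orbit_F2 R).
Proof.
apply: (simply_connected_retract (@orbit_split_continuous R)
  (@orbit_join_continuous R) (@orbit_splitK R)).
apply: simply_connected_prod; last exact: simply_connected_S3.
exact: simply_connected_punctured.
Qed.

End SimpleConnectivity.

(** * Maps into and out of wedges *)

Section Wedge.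
Variables (I : finType) (X : I -> topologicalType) (p0 : forall i, X i).
Hypothesis closed_p0 : forall i, closed [set p0 i].

(** A product of a quotient map with [T] need not be a quotient map, so continuity is checked on
    neighbourhoods. At the wedge point the neighbourhoods in [T] coming from the summands are
    intersected, which uses that [I] is finite. *)
Lemma wedge_fun_continuous2 (T Z : topologicalType)
    (F : forall i, T * X i -> Z) :
  (forall i, continuous (F i)) ->
  (forall t i j, F i (t, p0 i) = F j (t, p0 j)) ->
  continuous (fun p : T * wedge p0 => wedge_fun (fun i x => F i (p.1, x)) p.2).
Proof.
move=> cF Fp0 [t w] U /= nU.
pose G (p : T * wedge p0) : Z := wedge_fun (fun i x => F i (p.1, x)) p.2.
have GE s i (x : X i) : G (s, wedge_lift p0 x) = F i (s, x).
  by rewrite /G wedge_lift_funE// => j k; exact: Fp0.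
have near_lift i (x : X i) : w = wedge_lift p0 x -> exists A : set T,
    nbhs t A /\ nbhs x [set y | forall s, A s -> U (G (s, wedge_lift p0 y))].
  move=> wE; have /cF[[/= A B] [nA nB] AB] : nbhs (F i (t, x)) U.
    by rewrite -GE -wE.
  exists A; split => //; apply: filterS nB => y By s As.
  by rewrite GE; apply: AB.
suff [A [nA nw]] : exists A : set T,
    nbhs t A /\ nbhs w [set w' | forall s, A s -> U (G (s, w'))].
  exists (A, [set w' | forall s, A s -> U (G (s, w'))]) => //.
  by move=> [s w'] [/= As]; exact.
move: near_lift; case: (wedge_nbhs_specP w closed_p0) => [j|i x _]; last first.
  by move=> /(_ i x erefl)[A [nA nx]]; exists A.
move=> near_lift.
have /choice[A AP] : forall i, exists A : set T, nbhs t A /\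
    nbhs (p0 i) [set y | forall s, A s -> U (G (s, wedge_lift p0 y))].
  by move=> i; apply: near_lift; exact: wedge_liftE.
exists [set s | forall i, A i s]; split.
  by apply: (@filter_forall _ _ A (nbhs t)) => i; have [] := AP i.
move=> i _; have [_] := AP i; apply: (@filterS _ _ (nbhs_filter _)).
by move=> y Hy s As; apply: Hy.
Qed.

Variables (T : topologicalType) (f : forall i, T -> X i) (i0 : I).
Hypothesis cf : forall i, continuous (f i).
Hypothesis f_excl : forall t i j, f i t <> p0 i -> f j t <> p0 j -> i = j.

(** By [f_excl] at most one [f i t] is off its base point, so the choice made by [pick] is forced;
    [i0] only names the wedge point. *)
Definition wedge_of (t : T) : wedge p0 :=
  if [pick i | f i t != p0 i] is Some i then wedge_lift p0 (f i t)
  else wedge_lift p0 (p0 i0).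

Lemma wedge_ofE t i : f i t <> p0 i -> wedge_of t = wedge_lift p0 (f i t).
Proof.
move=> fi; rewrite /wedge_of; case: pickP => [j /eqP fj|/(_ i)/eqP//].
by rewrite (f_excl fi fj).
Qed.

Lemma wedge_of_base t : (forall i, f i t = p0 i) ->
  wedge_of t = wedge_lift p0 (p0 i0).
Proof.
move=> ft; rewrite /wedge_of; case: pickP => [j|//].
by rewrite ft eqxx.
Qed.

Lemma wedge_of_lift t i : (forall j, j <> i -> f j t = p0 j) ->
  wedge_of t = wedge_lift p0 (f i t).
Proof.
move=> fj; have [fi|] := pselect (f i t = p0 i); last exact: wedge_ofE.
rewrite wedge_of_base ?fi; first exact: wedge_liftE.
by move=> j; have [->//|/eqP/fj] := eqVneq j i.
Qed.

(** Where some [f i] is off the base point it remains so nearby, base points being closed. Elsewhere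
    all the finitely many lifts stay in [U] near [t]. *)
Lemma wedge_of_continuous : continuous wedge_of.
Proof.
move=> t U; have [[i fi]|nf] := pselect (exists i, f i t <> p0 i).
  rewrite (wedge_ofE fi) => nU.
  have nf : nbhs t (f i @^-1` (~` [set p0 i])).
    apply: cf; apply: open_nbhs_nbhs; split => //; exact: closed_openC.
  have nfU : nbhs t (f i @^-1` (wedge_lift p0 (i := i) @^-1` U)).
    by apply: cf; exact: wedge_lift_continuous.
  apply: (@filterS2 _ _ (nbhs_filter t) _ _ _ _ nf nfU) => s /= fs Us.
  by rewrite /preimage/= (wedge_ofE fs).
have ft i : f i t = p0 i by apply: contrapT => fi; apply: nf; exists i.
rewrite wedge_of_base// => nU.
have nfU : nbhs t [set s | forall i, U (wedge_lift p0 (f i s))].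
  apply: (@filter_forall _ _ (fun i s => U (wedge_lift p0 (f i s))) (nbhs t)).
  move=> i; apply: (@cf i t (wedge_lift p0 (i := i) @^-1` U)); rewrite ft.
  by apply: wedge_lift_continuous; rewrite (wedge_liftE p0 (p0 i0) (p0 i)).
apply: (@filterS _ _ (nbhs_filter t) _ _ _ nfU) => s Us.
have [[i fi]|nfs] := pselect (exists i, f i s <> p0 i).
  by rewrite /preimage/= (wedge_ofE fi); exact: Us.
rewrite /preimage/= wedge_of_base; first exact: nbhs_singleton nU.
by move=> i; apply: contrapT => fi; apply: nfs; exists i.
Qed.

End Wedge.

(** * The punctured sphere and the wedge *)

Section UnitVectors.
Variable R : realType.
Local Notation C := (R[i]^o).

(** Three-space as a vertical axis times a complex plane, with [S2_base] as north pole. *)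
Definition vec3 (h : R) (w : R[i]) : 'rV[R]_3 := \row_j [:: h; Re w; Im w]`_j.

Definition height (v : 'rV[R]_3) : R := v 0 0.

Definition horizontal (v : 'rV[R]_3) : C := v 0 1 +i* v 0 (@Ordinal 3 2 isT).

Definition norm3 (v : 'rV[R]_3) : R := \sum_(i < 3) v 0 i ^+ 2.

Lemma height_vec3 h w : height (vec3 h w) = h.
Proof. by rewrite /height mxE. Qed.

Lemma horizontal_vec3 h w : horizontal (vec3 h w) = w.
Proof. by rewrite /horizontal !mxE; case: w. Qed.

Lemma vec3E v : v = vec3 (height v) (horizontal v).
Proof.
apply/rowP => j; rewrite mxE.
by case: j => [[|[|[|//]]] jlt] /=; congr (v _ _); exact: val_inj.
Qed.

Lemma vec3Z (r h : R) w : r *: vec3 h w = vec3 (r * h) (r%:C * w).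
Proof.
apply/rowP => j; rewrite !mxE.
by case: j => [[|[|[|//]]] jlt] //=; rewrite !ReImE /=; ring.
Qed.

Lemma vec3D h h' w w' : vec3 h w + vec3 h' w' = vec3 (h + h') (w + w').
Proof.
apply/rowP => j; rewrite !mxE.
by case: j => [[|[|[|//]]] jlt] //=; rewrite !ReImE.
Qed.

Lemma norm3E v : norm3 v = height v ^+ 2 + normsq (horizontal v).
Proof.
rewrite /norm3 !big_ord_recl big_ord0 addr0 /normsq /=.
by do 3 ?congr (_ + _); congr (v _ _ ^+ 2); exact: val_inj.
Qed.

Lemma norm3_ge0 v : 0 <= norm3 v.
Proof. by rewrite norm3E addr_ge0 ?sqr_ge0 ?normsq_ge0. Qed.

Lemma norm3_eq0 v : (norm3 v == 0) = (v == 0).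
Proof.
apply/idP/eqP => [|->]; last first.
  by rewrite /norm3 big1// => i _; rewrite mxE expr0n.
rewrite norm3E paddr_eq0 ?sqr_ge0 ?normsq_ge0// sqrf_eq0 normsq_eq0.
move=> /andP[/eqP h0 /eqP w0]; rewrite [v]vec3E h0 w0.
by apply/rowP => j; rewrite !mxE; case: j => [[|[|[|//]]] jlt].
Qed.

Lemma vec3_neq0 h w : (h <> 0 \/ w <> 0) -> vec3 h w != 0.
Proof.
move=> hw; rewrite -norm3_eq0 norm3E height_vec3 horizontal_vec3.
rewrite paddr_eq0 ?sqr_ge0 ?normsq_ge0// sqrf_eq0 normsq_eq0.
by apply/negP => /andP[/eqP h0 /eqP w0]; case: hw.
Qed.

Lemma vec3_continuous_at (T : topologicalType) (x : T) (f : T -> R)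
    (g : T -> C) :
  continuous_at x f -> continuous_at x g ->
  continuous_at x (fun t => vec3 (f t) (g t)).
Proof.
move=> cf cg; apply: continuous_at_row => j.
have -> : (fun t => vec3 (f t) (g t) 0 j) =
    fun t => [:: f t; Re (g t); Im (g t)]`_j.
  by apply/funext => t; rewrite mxE.
case: j => [[|[|[|//]]] jlt] //=.
  exact: continuous_at_Re.
exact: continuous_at_Im.
Qed.

Lemma height_continuous : continuous height.
Proof. by move=> v; apply: continuous_at_coord; exact: cvg_id. Qed.

Lemma horizontal_continuous : continuous horizontal.
Proof.
by move=> v; apply: continuous_at_complex => /=;
  apply: continuous_at_coord; exact: cvg_id.
Qed.

Lemma norm3_continuous : continuous norm3.
Proof.
move=> v; rewrite /norm3; continuity; apply: continuous_at_coord; exact: cvg_id.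
Qed.

Definition unit3 (v : 'rV[R]_3) : 'rV[R]_3 := (Num.sqrt (norm3 v))^-1 *: v.

Definition toS2 (v : 'rV[R]_3) : S2 R := insubd (S2_base R) (unit3 v).

Lemma sqrt_norm3_gt0 v : v != 0 -> 0 < Num.sqrt (norm3 v).
Proof. by rewrite -norm3_eq0 sqrtr_gt0 lt_neqAle norm3_ge0 andbT eq_sym. Qed.

Lemma unit3_S2 v : v != 0 -> S2_set (unit3 v).
Proof.
move=> v0; rewrite /S2_set /= -/(norm3 (unit3 v)) [v]vec3E /unit3 vec3Z -vec3E.
rewrite norm3E height_vec3 horizontal_vec3 normsqM normsq_real exprMn -mulrDr.
by rewrite -norm3E exprVn sqr_sqrtr ?norm3_ge0// mulVf// norm3_eq0.
Qed.

Lemma val_toS2 v : v != 0 -> \val (toS2 v) = unit3 v.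
Proof. by move=> v0; rewrite val_insubd mem_set//; exact: unit3_S2. Qed.

Lemma norm3_S2 (x : S2 R) : norm3 (\val x) = 1.
Proof. exact: set_mem (valP x). Qed.

Lemma toS2_id (x : S2 R) : toS2 (\val x) = x.
Proof.
have x0 : \val x != 0 by rewrite -norm3_eq0 norm3_S2 oner_eq0.
by apply: val_inj; rewrite val_toS2// /unit3 norm3_S2 sqrtr1 invr1 scale1r.
Qed.

Lemma val_S2_base : \val (S2_base R) = vec3 1 0.
Proof.
by apply/rowP => j; rewrite !mxE; case: j => [[|[|[|//]]] jlt].
Qed.

Lemma unit3_axis (h : R) : unit3 (vec3 h 0) = vec3 (h / `|h|) 0.
Proof.
rewrite /unit3 vec3Z mulr0 norm3E height_vec3 horizontal_vec3.
by rewrite /normsq /= expr0n/= !addr0 sqrtr_sqr mulrC.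
Qed.

Lemma toS2_north h : 0 < h -> toS2 (vec3 h 0) = S2_base R.
Proof.
move=> h0; apply: val_inj; rewrite val_S2_base val_toS2; last first.
  by apply: vec3_neq0; left; apply/eqP; rewrite gt_eqF.
by rewrite unit3_axis gtr0_norm// divff// gt_eqF.
Qed.

Lemma toS2_continuous (v : 'rV[R]_3) : v != 0 -> continuous_at v toS2.
Proof.
move=> v0; apply: insubd_continuous.
  rewrite /unit3; continuity; last exact: norm3_continuous.
  by rewrite gt_eqF// sqrt_norm3_gt0.
have nv : nbhs (norm3 v) [set r : R | r != 0].
  by apply: open_nbhs_nbhs; split; [exact: open_neq|rewrite /= norm3_eq0].
apply: (@filterS _ _ (nbhs_filter v) _ _ _ (norm3_continuous nv)) => w /=.
by rewrite norm3_eq0 => w0; exact: unit3_S2.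
Qed.

Lemma closed_S2_base : closed [set S2_base R].
Proof.
have -> : [set S2_base R] = \val @^-1` [set \val (S2_base R)].
  by rewrite eqEsubset; split=> x [E]; [rewrite E|exact: val_inj].
apply: closed_comp; first by move=> x _; exact: set_val_continuous.
exact/accessible_closed_set1/hausdorff_accessible/norm_hausdorff.
Qed.

End UnitVectors.

Section PuncturedSphereWedge.
Variable R : realType.
Local Notation C := (R[i]^o).
Local Notation X := (punctured_S3 R).
Local Notation W := (wedge_S2 R 6).
Local Notation mid := (arc_mid R).

Lemma ord6_lt7 (i : 'I_6) : (i < 7)%N.
Proof. exact: leqW. Qed.

Lemma normsq_fst_le1 (x : C * C) : S3_set x -> normsq x.1 <= 1.
Proof. by move=> /S3_setP <-; rewrite lerDl normsq_ge0. Qed.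

(* The normalization of [pinch k] collapses the complement of the [k]-th cap to the
   base point of [S2] and is bijective on the part of the chord of [sphere_at] lying
   in the cap. *)
Definition pinch (k : nat) (q : C * C) : 'rV[R]_3 :=
  vec3 (normsq q.2 - cap k q.1) ((Num.max 0 (cap k q.1))%:C * q.2).

(** If both parts vanish, [q.2] is 0: otherwise [cap] is nonpositive and the height is a sum of
    nonnegative terms. Then [q] is on the circle with [cap k] equal to 0, while another cap contains
    it, against disjointness. *)
Lemma pinch_neq0 k q : (k < 7)%N -> punctured_set q -> pinch k q != 0.
Proof.
move=> k7 [qS qz]; apply: vec3_neq0; apply: contrapT => /not_orP[/contrapT qh].
move=> /contrapT/eqP qw.
have q20 : q.2 = 0.
  move: qw; rewrite mulf_eq0 => /orP[|/eqP//].
  rewrite -normsq_eq0 normsq_real sqrf_eq0 => /eqP m0.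
  have ck : cap k q.1 <= 0 by rewrite -m0 le_max lexx orbT.
  have : normsq q.2 <= 0 by move: qh; lra.
  by rewrite le_eqVlt ltNge normsq_ge0 orbF normsq_eq0 => /eqP.
have q1 : normsq q.1 = 1.
  by move/S3_setP : qS; rewrite q20 /normsq /= expr0n/= !addr0.
move: qh; rewrite q20 /normsq /= expr0n/= addr0 sub0r => /eqP.
rewrite oppr_eq0 => /eqP ck0.
have [|j j7 cj] := cap_cover q1.
  by move=> j qE; apply: (qz j); rewrite [q]surjective_pairing qE q20.
have kj : k = j by apply: (cap_disjoint k7 j7 _ _ cj); rewrite ?q1 ?ck0.
by move: cj; rewrite -kj ck0 ltxx.
Qed.

Lemma cap_continuous k : continuous (cap k : C -> R).
Proof. by move=> a; rewrite /cap; complex_continuity. Qed.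

Lemma pinch_continuous k : continuous (pinch k).
Proof.
move=> q; have cc : continuous_at q (fun q : C * C => cap k q.1).
  apply: (continuous_at_comp (g := cap k : C -> R)); last exact: cap_continuous.
  by complex_continuity.
by apply: vec3_continuous_at; complex_continuity; exact: cc.
Qed.

Definition collapse (i : 'I_6) (x : X) : S2 R := toS2 (pinch i (\val x)).

Lemma collapse_continuous i : continuous (collapse i).
Proof.
move=> x; apply: (continuous_at_comp (f := fun x : X => pinch i (\val x))).
  apply: (continuous_at_comp (g := pinch i)); last exact: pinch_continuous.
  exact: set_val_continuous.
apply: toS2_continuous; apply: pinch_neq0; first exact: ord6_lt7.
exact: set_mem (valP x).
Qed.

(** Outside the cap, [pinch] lies on the positive vertical axis. *)
Lemma collapse_base (i : 'I_6) (x : X) :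
  cap i (\val x).1 <= 0 -> collapse i x = S2_base R.
Proof.
move=> ci; have := pinch_neq0 (ord6_lt7 i) (set_mem (valP x)).
rewrite /collapse /pinch max_l// mul0r => p0.
apply: toS2_north; rewrite lt_neqAle subr_ge0.
rewrite (le_trans ci) ?normsq_ge0// andbT; apply/eqP => h0.
move/eqP : p0; apply; rewrite -h0.
by apply/rowP => j; rewrite !mxE; case: j => [[|[|[|//]]] jlt].
Qed.

Lemma collapse_excl (x : X) (i j : 'I_6) :
  collapse i x <> S2_base R -> collapse j x <> S2_base R -> i = j.
Proof.
move=> ci cj; apply: val_inj.
have pos k : collapse k x <> S2_base R -> 0 < cap k (\val x).1.
  by move=> ck; rewrite ltNge; apply/negP => /collapse_base.
have [xS _] := set_mem (valP x).
apply: (cap_disjoint (ord6_lt7 i) (ord6_lt7 j) (normsq_fst_le1 xS)).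
  exact/ltW/pos.
exact: pos.
Qed.

Definition sphere_incl (i : 'I_6) (v : S2 R) : W :=
  @wedge_lift 'I_6 (fun=> S2 R) (fun=> S2_base R) i v.

Definition to_wedge : X -> W :=
  @wedge_of 'I_6 (fun=> S2 R) (fun=> S2_base R) X collapse ord0.

Lemma to_wedge_continuous : continuous to_wedge.
Proof.
apply: wedge_of_continuous.
- by move=> i; exact: closed_S2_base.
- exact: collapse_continuous.
- exact: collapse_excl.
Qed.

Lemma to_wedge_lift (x : X) (i : 'I_6) :
  (forall j : 'I_6, j <> i -> cap j (\val x).1 <= 0) ->
  to_wedge x = sphere_incl i (collapse i x).
Proof.
move=> cj; apply: wedge_of_lift; first exact: collapse_excl.
by move=> j /cj/collapse_base.
Qed.

Lemma to_wedge_base (x : X) : (forall j : 'I_6, cap j (\val x).1 <= 0) ->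
  to_wedge x = sphere_incl ord0 (S2_base R).
Proof. by move=> cj; apply: wedge_of_base => j; exact: collapse_base. Qed.

Definition mixC (s : R) (q q' : C * C) : C * C :=
  (s%:C * q.1 + (1 - s)%:C * q'.1, s%:C * q.2 + (1 - s)%:C * q'.2).

Lemma normsq_mix (s : R) (a b : R[i]) :
  normsq (s%:C * a + (1 - s)%:C * b) =
  s * normsq a + (1 - s) * normsq b - s * (1 - s) * normsq (a - b).
Proof. by rewrite /normsq !ReImE /=; ring. Qed.

Definition half_chord (i : nat) : R := Num.sqrt (normsq (mid 6 - mid i)) / 2.

Lemma half_chord_ge0 i : 0 <= half_chord i.
Proof. by rewrite divr_ge0 ?sqrtr_ge0. Qed.

Lemma half_chord_gt0 i : (i < 6)%N -> 0 < half_chord i.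
Proof.
move=> i6; rewrite divr_gt0// sqrtr_gt0 lt_neqAle normsq_ge0 andbT eq_sym.
rewrite normsq_eq0 subr_eq0; apply/eqP => E.
have : cap i (mid 6) <= 0.
  by apply: cap_mid_le0 => //; [exact: leqW|move=> iE; rewrite iE in i6].
by rewrite E leNgt cap_mid.
Qed.

(** The north pole goes to m_6 for every [i], which lets the spheres be glued, and the south pole to
    m_i; the horizontal plane is scaled into the second coordinate. *)
Definition sphere_at (i : nat) (v : 'rV[R]_3) : C * C :=
  let s := (1 + height v) / 2 in
  (s%:C * mid 6 + (1 - s)%:C * mid i, (half_chord i)%:C * horizontal v).

(** The deficit of the squared norm along the chord is exactly what the horizontal part restores.
    The sphere meets the circle only at the poles, which are midpoints of arcs. *)
Lemma sphere_at_punctured i v : (i < 6)%N -> norm3 v = 1 ->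
  punctured_set (sphere_at i v).
Proof.
move=> i6; rewrite norm3E => v1; split.
  apply/S3_setP; rewrite /= normsq_mix !normsq_circ normsqM normsq_real.
  rewrite expr_div_n sqr_sqrtr ?normsq_ge0//.
  have -> : normsq (horizontal v) = 1 - height v ^+ 2 by rewrite -v1; ring.
  by field.
move=> j E; have E1 := congr1 fst E; have /eqP := congr1 snd E.
rewrite [in X in X -> _]/= mulf_eq0 -normsq_eq0 normsq_real sqrf_eq0.
rewrite gt_eqF ?half_chord_gt0//= => /eqP w0.
have : height v ^+ 2 = 1 by rewrite -v1 w0 /normsq/= expr0n/= !addr0.
move=> /eqP; rewrite sqrf_eq1 => /orP[|] /eqP h1; move: E1;
  rewrite /sphere_at h1 [in X in X -> _]/=.
  have -> : (1 + 1) / 2 = 1 :> R by field.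
  by rewrite subrr mul1r mul0r addr0; exact: arc_mid_neq_zeta.
rewrite subrr mul0r subr0 mul0r add0r mul1r; apply: arc_mid_neq_zeta.
exact: leqW.
Qed.

Definition sphere_map (i : 'I_6) (v : S2 R) : X :=
  exist _ (sphere_at i (\val v))
    (mem_set (sphere_at_punctured (ltn_ord i) (norm3_S2 v))).

Lemma sphere_map_continuous i : continuous (sphere_map i).
Proof.
move=> v; apply: continuous_at_set_type.
have ch : continuous_at v (fun v : S2 R => height (\val v)).
  apply: (continuous_at_comp (g := @height R)); last exact: height_continuous.
  exact: set_val_continuous.
have cw : continuous_at v (fun v : S2 R => horizontal (\val v)).
  apply: (continuous_at_comp (g := @horizontal R)).
    exact: set_val_continuous.
  exact: horizontal_continuous.
by rewrite /= /sphere_at; complex_continuity; (exact: ch || exact: cw).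
Qed.

Lemma sphere_map_base i : sphere_map i (S2_base R) = punctured_base R.
Proof.
apply: val_inj; rewrite -[LHS]/(sphere_at i (\val (S2_base R))) val_S2_base.
rewrite /sphere_at height_vec3 horizontal_vec3.
have -> : (1 + 1) / 2 = 1 :> R by field.
by rewrite subrr mul1r mul0r addr0 mulr0.
Qed.

Definition from_wedge : W -> X :=
  @wedge_fun 'I_6 (fun=> S2 R) (fun=> S2_base R) X sphere_map.

Lemma from_wedge_continuous : continuous from_wedge.
Proof.
apply: wedge_fun_continuous; first exact: sphere_map_continuous.
by move=> i j; rewrite !sphere_map_base.
Qed.

Lemma from_wedge_lift i (v : S2 R) :
  from_wedge (sphere_incl i v) = sphere_map i v.
Proof.
rewrite /from_wedge /sphere_incl wedge_lift_funE// => j k.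
by rewrite !sphere_map_base.
Qed.

End PuncturedSphereWedge.

(** * The two composites are homotopic to the identity *)

Section WedgeEquivalence.
Variable R : realType.
Local Notation C := (R[i]^o).
Local Notation X := (punctured_S3 R).
Local Notation W := (wedge_S2 R 6).
Local Notation mid := (arc_mid R).

Lemma punctured_fst_le1 (x : X) : normsq (\val x).1 <= 1.
Proof. by have [/normsq_fst_le1] := set_mem (valP x). Qed.

Lemma cap_pos_others (x : X) (k : nat) (j : 'I_6) : (k < 7)%N ->
  0 < cap k (\val x).1 -> (j : nat) <> k -> cap j (\val x).1 <= 0.
Proof.
move=> k7 ck jk; rewrite leNgt; apply/negP => cj; apply: jk.
exact: (cap_disjoint (ord6_lt7 j) k7 (punctured_fst_le1 x) (ltW cj) ck).
Qed.

Lemma roundtrip_cases (x : X) :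
  (exists i : 'I_6, from_wedge (to_wedge x) = sphere_map i (collapse i x)) \/
  from_wedge (to_wedge x) = punctured_base R.
Proof.
have [[i ci]|nc] := pselect (exists i : 'I_6, 0 < cap i (\val x).1).
  left; exists i; rewrite (@to_wedge_lift R x i) ?from_wedge_lift// => j ji.
  by apply: (cap_pos_others (ord6_lt7 i) ci) => /val_inj.
right; rewrite to_wedge_base ?from_wedge_lift ?sphere_map_base// => j.
by rewrite leNgt; apply/negP => cj; apply: nc; exists j.
Qed.

Lemma roundtrip_snd (x : X) : exists2 mu : R, 0 <= mu &
  (\val (from_wedge (to_wedge x))).2 = mu%:C * (\val x).2.
Proof.
have [[i ->]| ->] := roundtrip_cases x; last first.
  by exists 0 => //; rewrite mul0r.
pose p := pinch i (\val x).
have p0 : p != 0 by apply: pinch_neq0; [exact: ord6_lt7|exact: set_mem (valP x)].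
exists (half_chord R i * (Num.sqrt (norm3 p))^-1 *
    Num.max 0 (cap i (\val x).1)).
  by rewrite !mulr_ge0 ?half_chord_ge0 ?invr_ge0 ?sqrtr_ge0// le_max lexx.
rewrite -[LHS]/((half_chord R i)%:C * horizontal (\val (collapse i x))).
rewrite val_toS2// /unit3 /pinch vec3Z horizontal_vec3.
by rewrite !rmorphM/= !mulrA.
Qed.

(** Each open arc of the circle is sent to its own midpoint: the first six through the south poles
    of their spheres, the seventh because the base point is m_6. *)
Lemma roundtrip_axis (x : X) : (\val x).2 = 0 -> exists k : nat,
  [/\ (k < 7)%N, 0 < cap k (\val x).1 &
    \val (from_wedge (to_wedge x)) = (mid k : C, 0 : C)].
Proof.
move=> x20; have [/S3_setP xS xz] := set_mem (valP x).
have x1 : normsq (\val x).1 = 1.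
  by rewrite -xS x20 /normsq /= expr0n/= !addr0.
have [|k k7 ck] := cap_cover x1.
  by move=> j xj; apply: (xz j); rewrite [LHS]surjective_pairing xj x20.
exists k; split => //; have [k6|k6] := ltnP k 6; last first.
  have kE : k = 6%N by apply/eqP; rewrite eqn_leq k6 -ltnS k7.
  rewrite to_wedge_base ?from_wedge_lift ?sphere_map_base ?kE// => j.
  by apply: (cap_pos_others k7 ck) => jk; have := ltn_ord j; rewrite jk kE.
pose i := Ordinal k6.
rewrite (@to_wedge_lift R x i) ?from_wedge_lift; last first.
  by move=> j ji; apply: (cap_pos_others k7 ck) => jk; apply: ji; exact: val_inj.
have p0 : pinch i (\val x) != 0.
  by apply: pinch_neq0; [exact: k7|exact: set_mem (valP x)].
(* With second coordinate 0 and [cap] positive, [pinch] is on the negative vertical axis. *)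
have vE : \val (collapse i x) = vec3 (-1) 0.
  rewrite val_toS2// /pinch x20 mulr0 unit3_axis.
  have -> : normsq (0 : R[i]) = 0 by apply/eqP; rewrite normsq_eq0.
  by rewrite sub0r normrN gtr0_norm// mulNr divff// gt_eqF.
rewrite -[LHS]/(sphere_at i (\val (collapse i x))) vE /sphere_at.
rewrite height_vec3 horizontal_vec3 subrr mul0r subr0 mulr0.
by rewrite !mul0r add0r mul1r.
Qed.

(** On the circle [cap k] is positive at both ends of the segment, hence along it, but nonpositive
    on the rays within the disc. Off the circle, the second coordinate is a nonnegative multiple of
    that of [x] and can vanish only at [s = 0], where the point is in the punctured sphere. *)
Lemma off_rays_roundtrip (x : X) (s : R) : 0 <= s <= 1 ->
  off_rays (mixC s (\val x) (\val (from_wedge (to_wedge x)))).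
Proof.
move=> s01 j /ray_dist_eq0[t t0 E].
have [x20|x20] := eqVneq (\val x).2 0.
  have [k [k7 ck GE]] := roundtrip_axis x20.
  have E1 : s%:C * (\val x).1 + (1 - s)%:C * mid k = t%:C * zeta7 R ^+ j.
    by have := congr1 fst E; rewrite /mixC GE.
  have cpos : 0 < cap k (t%:C * zeta7 R ^+ j).
    rewrite -E1 cap_convex; case/andP: s01 => s0 s1; have cm := cap_mid R k.
    have [->|s00] := eqVneq s 0; first by rewrite mul0r add0r subr0 mul1r.
    have s0' : 0 < s by rewrite lt_neqAle eq_sym s00.
    rewrite ltr_pwDl ?mulr_gt0//.
    by apply: mulr_ge0; [rewrite subr_ge0|exact: ltW].
  have t1 : t ^+ 2 <= 1.
    have -> : t ^+ 2 = normsq (t%:C * zeta7 R ^+ j).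
      by rewrite normsqM normsq_real normsq_zeta7X mulr1.
    rewrite -E1 normsq_mix normsq_circ; case/andP: s01 => s0 s1.
    have := punctured_fst_le1 x; have := normsq_ge0 ((\val x).1 - mid k).
    set N := normsq (_ - _); set M := normsq _ => N0 M1.
    have : 0 <= s * (1 - s) * N by rewrite !mulr_ge0// subr_ge0.
    have : s * M <= s by rewrite ler_piMr.
    by lra.
  move: cpos; rewrite ltNge cap_ray_le0// t0/=.
  by rewrite -(ler_pXn2r (n := 2)) ?nnegrE// expr1n.
have [mu mu0 GE] := roundtrip_snd x.
have /eqP : (s + (1 - s) * mu)%:C * (\val x).2 = 0.
  have E2 : s%:C * (\val x).2 +
      (1 - s)%:C * (\val (from_wedge (to_wedge x))).2 = 0 := congr1 snd E.
  by rewrite -E2 GE rmorphD rmorphM/= mulrDl mulrA.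
rewrite mulf_eq0 (negbTE x20) orbF -normsq_eq0 normsq_real sqrf_eq0.
case/andP: s01 => s0 s1.
rewrite paddr_eq0 ?mulr_ge0 ?subr_ge0// => /andP[/eqP s00 _].
have := punctured_off_rays (set_mem (valP (from_wedge (to_wedge x)))).
move=> /(_ j); apply; rewrite -(ray_dist_ray j t0) -E s00 /mixC subr0.
by rewrite !mul0r !add0r !mul1r -surjective_pairing.
Qed.

Lemma homotopic_from_to : homotopic R (@from_wedge R \o @to_wedge R) id.
Proof.
pose mix (p : R * X) :=
  mixC (clamp p.1) (\val p.2) (\val (from_wedge (to_wedge p.2))).
have mixP p : off_rays (mix p) by apply: off_rays_roundtrip; exact: clamp_itv.
pose H (p : R * X) : X := insubd (punctured_base R) (unitize (mix p)).
have valH p : \val (H p) = unitize (mix p).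
  by rewrite val_insubd mem_set//; exact: unitize_punctured.
apply: (@homotopic_continuous R X X _ _ H).
- move=> p; apply: insubd_continuous; last first.
    apply: (@filterE _ _ (nbhs_filter p)) => q.
    exact: unitize_punctured.
  apply: (continuous_at_comp (f := mix)); last first.
    exact/unitize_continuous/off_rays_neq0.
  have cc : continuous_at p (fun p : R * X => clamp p.1).
    apply: (continuous_at_comp (g := @clamp R)); last exact: clamp_continuous.
    by continuity.
  have cr : continuous_at p (fun p : R * X => from_wedge (to_wedge p.2)).
    apply: (continuous_at_comp (g := @from_wedge R)); last first.
      exact: from_wedge_continuous.
    apply: (continuous_at_comp (g := @to_wedge R)); last first.
      exact: to_wedge_continuous.
    exact: cvg_snd.
  by rewrite /mix /mixC; complex_continuity; (exact: cc || exact: cr).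
- move=> x; apply: val_inj; rewrite valH /mix clamp0 /mixC subr0.
  rewrite !mul0r !add0r !mul1r -surjective_pairing unitize_id//.
  by have [] := set_mem (valP (from_wedge (to_wedge x))).
- move=> x; apply: val_inj; rewrite valH /mix clamp1 /mixC subrr.
  rewrite !mul0r !addr0 !mul1r -surjective_pairing unitize_id//.
  by have [] := set_mem (valP x).
Qed.

Definition sphere_homotopy_vec (i : 'I_6) (p : R * S2 R) : 'rV[R]_3 :=
  (1 - clamp p.1) *: pinch i (\val (sphere_map i p.2)) + clamp p.1 *: \val p.2.

(** The horizontal direction is kept, so a segment from this vector to [v] can meet 0 only over a
    pole. *)
Lemma sphere_pinch (i : 'I_6) (v : S2 R) : exists2 b : R, 0 <= b &
  pinch i (\val (sphere_map i v)) =
  vec3 (height (pinch i (\val (sphere_map i v)))) (b%:C * horizontal (\val v)).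
Proof.
exists (Num.max 0 (cap i (\val (sphere_map i v)).1) * half_chord R i).
  by rewrite mulr_ge0 ?half_chord_ge0// le_max lexx.
by rewrite /pinch height_vec3 rmorphM /= mulrA.
Qed.

(** At the poles the height of [pinch] is [- cap i] at m_6 or m_i: nonnegative at the north pole,
    negative at the south pole, so it never cancels the height of [v]. *)
Lemma sphere_homotopy_vec_neq0 i p : sphere_homotopy_vec i p != 0.
Proof.
case: p => s v; rewrite /sphere_homotopy_vec /=.
set c := clamp s; have /andP[c0 c1] : 0 <= c <= 1 by exact: clamp_itv.
have p0 : pinch i (\val (sphere_map i v)) != 0.
  by apply: pinch_neq0; [exact: ord6_lt7|exact: set_mem (valP _)].
have [->|c00] := eqVneq c 0; first by rewrite subr0 scale1r scale0r addr0.
have cpos : 0 < c by rewrite lt_neqAle eq_sym c00.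
have [b b0 pE] := sphere_pinch i v.
rewrite pE [X in _ + _ *: X]vec3E !vec3Z vec3D; apply: vec3_neq0.
set w := horizontal (\val v); set h := height (\val v).
have [w0|w0] := eqVneq w 0; last first.
  right=> /eqP; rewrite mulrA -rmorphM -mulrDl -rmorphD mulf_eq0 (negbTE w0).
  rewrite orbF -normsq_eq0 normsq_real sqrf_eq0 gt_eqF//.
  by rewrite ltr_wpDl// mulr_ge0// subr_ge0.
left.
have h1 : h ^+ 2 = 1.
  rewrite -(norm3_S2 v) norm3E -/h -/w w0.
  by rewrite /normsq /= expr0n/= !addr0.
have hE : height (pinch i (\val (sphere_map i v))) =
    - cap i ((\val (sphere_map i v)).1).
  rewrite height_vec3 -[(\val (sphere_map i v)).2]/((half_chord R i)%:C * w).
  rewrite w0 mulr0 (_ : normsq 0 = 0) ?sub0r//.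
  by apply/eqP; rewrite normsq_eq0.
have fE : (\val (sphere_map i v)).1 =
  ((1 + h) / 2)%:C * mid 6 + (1 - (1 + h) / 2)%:C * mid i by [].
move/eqP : h1; rewrite hE fE sqrf_eq1 => /orP[|] /eqP hh; rewrite hh.
  have -> : (1 + 1) / 2 = 1 :> R by field.
  rewrite subrr mul1r mul0r addr0 mulr1; apply/eqP; rewrite gt_eqF//.
  rewrite ltr_wpDl// mulr_ge0 ?subr_ge0// oppr_ge0; apply: cap_mid_le0 => //.
    exact: ord6_lt7.
  by have := ltn_ord i; lia.
rewrite subrr mul0r subr0 mul0r add0r mul1r mulrN1; apply/eqP; rewrite lt_eqF//.
have := cap_mid R i; have : 0 <= 1 - c by rewrite subr_ge0.
by move: cpos; set a := cap _ _; nra.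
Qed.

Definition sphere_homotopy (i : 'I_6) (p : R * S2 R) : S2 R :=
  toS2 (sphere_homotopy_vec i p).

Lemma sphere_homotopy_continuous i : continuous (sphere_homotopy i).
Proof.
move=> p; apply: (continuous_at_comp (f := sphere_homotopy_vec i)); last first.
  exact/toS2_continuous/sphere_homotopy_vec_neq0.
have cc : continuous_at p (fun p : R * S2 R => clamp p.1).
  apply: (continuous_at_comp (g := @clamp R)); last exact: clamp_continuous.
  by continuity.
have c2 : continuous_at p (fun p : R * S2 R => \val p.2).
  by apply: continuous_at_val; exact: cvg_snd.
have cp : continuous_at p (fun p : R * S2 R => pinch i (\val (sphere_map i p.2))).
  apply: (continuous_at_comp (g := pinch i)); last exact: pinch_continuous.
  apply: continuous_at_val.
  apply: (continuous_at_comp (g := sphere_map i)); last first.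
    exact: sphere_map_continuous.
  exact: cvg_snd.
rewrite /sphere_homotopy_vec; continuity; first
  [exact: cc|exact: c2|exact: cp].
Qed.

(** The base point stays fixed, so that the homotopies of the six spheres glue on the wedge. *)
Lemma sphere_homotopy_base i s : sphere_homotopy i (s, S2_base R) = S2_base R.
Proof.
have := sphere_homotopy_vec_neq0 i (s, S2_base R).
rewrite /sphere_homotopy /sphere_homotopy_vec; cbn [fst snd].
set c := clamp s; have /andP[c0 c1] : 0 <= c <= 1 by exact: clamp_itv.
have [b b0 pE] := sphere_pinch i (S2_base R).
rewrite pE val_S2_base horizontal_vec3 mulr0 !vec3Z !mulr0 vec3D addr0 mulr1.
set h := height _ => v0; apply: toS2_north; rewrite lt_neqAle.
have h0 : 0 <= h.
  rewrite /h sphere_map_base height_vec3 /= subr_ge0.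
  rewrite (@le_trans _ _ 0) ?normsq_ge0//; apply: cap_mid_le0 => //.
    exact: ord6_lt7.
  by have := ltn_ord i; lia.
rewrite addr_ge0 ?mulr_ge0 ?subr_ge0// andbT; apply/eqP => e0.
move/eqP : v0; apply; rewrite -e0.
by apply/rowP => j; rewrite !mxE; case: j => [[|[|[|//]]] jlt].
Qed.

(** The first coordinate runs along the chord from m_6 to m_i, where every other [cap j] is
    nonpositive because it is so at both ends. *)
Lemma to_wedge_sphere_map i (v : S2 R) :
  to_wedge (sphere_map i v) = sphere_incl i (collapse i (sphere_map i v)).
Proof.
apply: to_wedge_lift => j ji.
rewrite -[(\val _).1]/(_ * mid 6 + _ * mid i) cap_convex.
set s := (_ / 2); have s01 : 0 <= s <= 1.
  have := norm3_S2 v; rewrite norm3E.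
  have := normsq_ge0 (horizontal (\val v)); rewrite /s.
  set h := height _ => w0 hw.
  have : h ^+ 2 <= 1 by move: w0 hw; set n := normsq _; lra.
  by move=> h1; apply/andP; split; nra.
case/andP: s01 => s0 s1.
have c6 : cap j (mid 6) <= 0.
  by apply: cap_mid_le0 => //; [exact: ord6_lt7|have := ltn_ord j; lia].
have ci : cap j (mid i) <= 0.
  apply: cap_mid_le0; try exact: ord6_lt7.
  by move=> /val_inj.
by rewrite -[leRHS]addr0 lerD// mulr_ge0_le0// subr_ge0.
Qed.

Lemma homotopic_to_from : homotopic R (@to_wedge R \o @from_wedge R) id.
Proof.
have base s (i j : 'I_6) :
    sphere_incl i (sphere_homotopy i (s, S2_base R)) =
    sphere_incl j (sphere_homotopy j (s, S2_base R)).
  rewrite !sphere_homotopy_base.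
  exact: (@wedge_liftE 'I_6 (fun=> S2 R) (fun=> S2_base R) j (S2_base R) i
    (S2_base R)).
have wE (w : W) : exists i v, w = sphere_incl i v.
  have : [set: W] w by [].
  by rewrite -wedgeTE => -[i _ [v _ <-]]; exists i, v.
pose H (p : R * W) : W := @wedge_fun 'I_6 (fun=> S2 R) (fun=> S2_base R) W
  (fun i v => sphere_incl i (sphere_homotopy i (p.1, v))) p.2.
have HE s i v : H (s, sphere_incl i v) =
    sphere_incl i (sphere_homotopy i (s, v)).
  by rewrite /H /sphere_incl wedge_lift_funE// => j k; exact: base.
apply: (@homotopic_continuous R W W _ _ H).
- apply: (@wedge_fun_continuous2 'I_6 (fun=> S2 R) (fun=> S2_base R) _ R W
    (fun i p => sphere_incl i (sphere_homotopy i p))).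
  + by move=> i; exact: closed_S2_base.
  + move=> i p; apply: (continuous_at_comp (g := sphere_incl i)).
      exact: sphere_homotopy_continuous.
    exact: wedge_lift_continuous.
  + by move=> s i j; exact: base.
- move=> w; have [i [v ->]] := wE w; rewrite HE /= from_wedge_lift.
  rewrite to_wedge_sphere_map /sphere_homotopy /sphere_homotopy_vec /=.
  by rewrite clamp0 subr0 scale1r scale0r addr0.
- move=> w; have [i [v ->]] := wE w; rewrite HE /=.
  rewrite /sphere_homotopy /sphere_homotopy_vec /= clamp1 subrr scale0r.
  by rewrite add0r scale1r toS2_id.
Qed.

Lemma punctured_S3_wedge : homotopy_equivalent R X W.
Proof.
exists (@to_wedge R), (@from_wedge R); split.
- exact: to_wedge_continuous.
- exact: from_wedge_continuous.
- exact: homotopic_from_to.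
- exact: homotopic_to_from.
Qed.

End WedgeEquivalence.

Theorem proposition2p1 (R : realType) :
  universal_covering R (@orbit_F2_proj R) /\
  homotopy_equivalent R (orbit_F2 R) (wedge_S2 R 6 * S3 R)%type.
Proof.
split.
  split; first exact: orbit_F2_proj_covering.
  exact: simply_connected_orbit_F2.
apply: (homotopy_equivalent_homeo (@orbit_split_continuous R)
  (@orbit_join_continuous R) (@orbit_splitK R) (@orbit_joinK R)).
by apply: homotopy_equivalent_prod; exact: punctured_S3_wedge.
Qed.
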